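(* Let $\Gamma=(V,E,s,r)$ be a finite directed graph. Then the center $Z(CK(\Gamma))$ of the Cuntz-Krieger $C^*$-algebra $CK(\Gamma)$ is spanned (as a complex vector space) by: (i) the central idempotents $e(W)=\sum_{p\in Arr(W)}pp^*$, where $W$ runs over all nonempty hereditary finitary subsets of $V$; (ii) the subspaces $\left\{\sum_{p\in Arr(C)}pzp^*\mid z\in Z(C)\right\}$, where $C$ runs over all finitary $NE$-cycles of $\Gamma$.
   Context: A directed graph $\Gamma=(V,E,s,r)$ consists of a set $V$ of vertices, a set $E$ of edges, and maps $s,r:E\to V$ (source and range). It is finite if $V$ and $E$ are finite. $CK(\Gamma)$ is the universal $C^*$-algebra generated by $V\cup E$, where the elements of $V$ are mutually orthogonal projections, subject to: (1) $s(e)e=er(e)=e$ for all $e\in E$; (2) $e^*f=\delta_{e,f}r(f)$ for all $e,f\in E$; (3) $v=\sum_{e\in s^{-1}(v)}ee^*$ whenever $s^{-1}(v)\neq\emptyset$. A path is a finite sequence $p=e_1\cdots e_n$ of edges with $r(e_i)=s(e_{i+1})$ for $1\le i\le n-1$; put $s(p)=s(e_1)$, $r(p)=r(e_n)$. Vertices $v$ are paths of length zero with $s(v)=r(v)=v$. Paths are viewed as elements of $CK(\Gamma)$ by multiplying their edges. A vertex $w$ is a descendant of $v$ if there is a path $p$ with $s(p)=v$, $r(p)=w$. A subset $W\subseteq V$ is hereditary if all descendants of every $w\in W$ lie in $W$. For nonempty $W\subseteq V$, an arrival path in $W$ is a path $p$ such that $r(p)\in W$ and $r(p)$ is the first vertex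 on $p$ that lies in $W$; in particular every $w\in W$, viewed as a path of length zero, is an arrival path in $W$. $Arr(W)$ is the set of all arrival paths in $W$. A hereditary set $W$ is finitary if $|Arr(W)|<\infty$; in this case $e(W)=\sum_{p\in Arr(W)}pp^*$ is a central idempotent of $CK(\Gamma)$. A cycle is a path $C=e_1\cdots e_n$, $n\ge1$, with $s(e_1)=r(e_n)$ and $s(e_1),\dots,s(e_n)$ distinct; $V(C)=\{s(e_1),\dots,s(e_n)\}$. An edge $e$ is an exit from $C$ if $s(e)\in V(C)$ but $e\notin\{e_1,\dots,e_n\}$. An $NE$-cycle is a cycle without an exit; then $V(C)$ is hereditary. Put $Arr(C)=Arr(V(C))$; $C$ is finitary if $V(C)$ is finitary. For an $NE$-cycle $C$, $CK(C)$ is the $C^*$-subalgebra of $CK(\Gamma)$ generated by $V(C)$ and $e_1,\dots,e_n$ (isomorphic to $M_n(T)$, where $T$ is the $C^*$-algebra of continuous complex functions on the unit circle), and $Z(C)$ denotes the center of $CK(C)$; it is the $C^*$-algebra generated by $z(C)=e_1\cdots e_n+e_2e_3\cdots e_ne_1+\cdots+e_ne_1\cdots e_{n-1}$. *)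

(* Defs.v *)
From HB Require Import structures.
From mathcomp Require Import all_boot all_order all_algebra.
From mathcomp Require Import complex.
From mathcomp Require Import all_classical all_reals all_analysis.

Set Implicit Arguments.
Unset Strict Implicit.
Unset Printing Implicit Defensive.

Import Order.TTheory GRing.Theory Num.Theory.
Import numFieldNormedType.Exports.

Local Open Scope classical_set_scope.
Local Open Scope ring_scope.

(** * C*-algebras *)

(* C*-algebras are not assumed to have a unit, so the product cannot be that of
   a MathComp ring structure and is declared here.  The scalars are the complex
   numbers R[i] and the norm is R[i]-valued, as in any normedModType R[i]. *)
HB.mixin Record isCStarAlgebra (R : realType) A
    of CompleteNormedModule R[i] A := {
  cmul : A -> A -> A;
  cstar : A -> A;
  cmulA : associative cmul;
  cmulDl : left_distributive cmul +%R;
  cmulDr : right_distributive cmul +%R;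
  cmulZl : forall (a : R[i]) (x y : A), cmul (a *: x) y = a *: cmul x y;
  cmulZr : forall (a : R[i]) (x y : A), cmul x (a *: y) = a *: cmul x y;
  cstarD : {morph cstar : x y / x + y};
  cstarZ : forall (a : R[i]) (x : A), cstar (a *: x) = a^* *: cstar x;
  cstarM : forall x y : A, cstar (cmul x y) = cmul (cstar y) (cstar x);
  cstarK : involutive cstar;
  normr_cmul : forall x y : A, `|cmul x y| <= `|x| * `|y|;
  normr_cstar_cmul : forall x : A, `|cmul (cstar x) x| = `|x| ^+ 2
}.

#[short(type="cstarAlgType")]
HB.structure Definition CStarAlgebra (R : realType) :=
  {A of isCStarAlgebra R A & CompleteNormedModule R[i] A}.

Declare Scope cstar_scope.
Delimit Scope cstar_scope with cstar.
Notation "x ** y" := (cmul x y)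
  (at level 40, left associativity) : cstar_scope.
Notation "x ^†" := (cstar x)
  (at level 1, left associativity, format "x ^†") : cstar_scope.
Local Open Scope cstar_scope.

Section CStarAlgebraTheory.
Context {R : realType}.

Definition star_hom (A B : cstarAlgType R) (f : {linear A -> B}) : Prop :=
  (forall x y, f (x ** y) = f x ** f y) /\ (forall x, f x^† = (f x)^†).

Variable A : cstarAlgType R.

Definition cstar_subalg (M : set A) : Prop :=
  [/\ M 0,
      forall (a : R[i]) x y, M x -> M y -> M (a *: x + y),
      forall x y, M x -> M y -> M (x ** y),
      forall x, M x -> M x^† &
      closed M].

Definition cstar_gen (X : set A) : set A := smallest cstar_subalg X.

Definition center_of (M : set A) : set A :=
  [set z | M z /\ forall x, M x -> z ** x = x ** z].

Definition lin_span (X : set A) : set A :=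
  smallest (fun M => M 0 /\
    forall (a : R[i]) x y, M x -> M y -> M (a *: x + y)) X.

End CStarAlgebraTheory.

(** * Finite directed graphs *)

Record fin_digraph := FinDigraph {
  vert : finType;
  edge : finType;
  src : edge -> vert;
  rng : edge -> vert
}.
Arguments src {f} e.
Arguments rng {f} e.

Section Graph.
Variable G : fin_digraph.

(* The path e_1 ... e_n with n >= 1 is encoded as (src e_1, [:: e_1; ...; e_n])
   and the path of length zero at v as (v, [::]). *)
Definition prepath := (vert G * seq (edge G))%type.

Fixpoint chain (v : vert G) (es : seq (edge G)) : bool :=
  if es is e :: es' then (src e == v) && chain (rng e) es' else true.

Definition is_path (p : prepath) : bool := chain p.1 p.2.

Definition path_src (p : prepath) : vert G := p.1.
Definition path_rng (p : prepath) : vert G := last p.1 (map rng p.2).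

Definition descendant (v w : vert G) : Prop :=
  exists p, [/\ is_path p, path_src p = v & path_rng p = w].

Definition hereditary (W : set (vert G)) : Prop :=
  forall w u, W w -> descendant w u -> W u.

(* belast p.1 (map rng p.2) lists, with repetitions, the vertices met by p
   strictly before its last one; hence p stops as soon as it enters W. *)
Definition Arr (W : set (vert G)) : set prepath :=
  [set p | [/\ is_path p, W (path_rng p) &
     forall v, v \in belast p.1 (map rng p.2) -> ~ W v]].

Definition finitary (W : set (vert G)) : Prop :=
  hereditary W /\ finite_set (Arr W).

(* path.cycle requires rng e_i = src e_(i+1) for i < n and rng e_n = src e_1. *)
Definition is_cycle (C : seq (edge G)) : Prop :=
  [/\ C != [::], cycle (fun e f => rng e == src f) C & uniq (map src C)].

Definition cycle_vert (C : seq (edge G)) : set (vert G) :=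
  [set v | v \in map src C].

Definition exit_of (C : seq (edge G)) (e : edge G) : Prop :=
  cycle_vert C (src e) /\ e \notin C.

Definition NE_cycle (C : seq (edge G)) : Prop :=
  is_cycle C /\ ~ exists e, exit_of C e.

Definition finitary_NE_cycle (C : seq (edge G)) : Prop :=
  NE_cycle C /\ finitary (cycle_vert C).

End Graph.

(** * Cuntz-Krieger algebras *)

Section CuntzKrieger.
Context {R : realType} {G : fin_digraph}.

Definition projection (A : cstarAlgType R) (x : A) : Prop :=
  x ** x = x /\ x^† = x.

Record CK_family (A : cstarAlgType R)
    (P : vert G -> A) (S : edge G -> A) : Prop := {
  CK_proj : forall v, projection (P v);
  CK_orth : forall v w, v != w -> P v ** P w = 0;
  CK_src : forall e, P (src e) ** S e = S e;
  CK_rng : forall e, S e ** P (rng e) = S e;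
  CK_star : forall e f, (S e)^† ** S f = if e == f then P (rng e) else 0;
  CK_sum : forall v, (exists e : edge G, src e = v) ->
    P v = \sum_(e | src e == v) S e ** (S e)^†
}.

(* A, with the elements P v and S e, is the universal C*-algebra generated by
   a Cuntz-Krieger family.  Since A is generated by the family and *-
   homomorphisms are continuous, the homomorphism f is unique. *)
Definition is_CK_algebra (A : cstarAlgType R)
    (P : vert G -> A) (S : edge G -> A) : Prop :=
  [/\ CK_family P S,
      cstar_gen (range P `|` range S) = setT &
      forall (B : cstarAlgType R) (Q : vert G -> B) (T : edge G -> B),
        CK_family Q T ->
        exists f : {linear A -> B},
          [/\ star_hom f, forall v, f (P v) = Q v & forall e, f (S e) = T e]].

Variables (A : cstarAlgType R) (P : vert G -> A) (S : edge G -> A).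

Definition path_elt (p : prepath G) : A :=
  if p.2 is e :: es then foldl (fun x f => x ** S f) (S e) es else P p.1.

Definition idem (W : set (vert G)) : A :=
  \sum_(p \in Arr W) path_elt p ** (path_elt p)^†.

Definition CK_cycle (C : seq (edge G)) : set A :=
  cstar_gen ((P @` cycle_vert C) `|` (S @` [set e | e \in C])).

Definition center_cycle (C : seq (edge G)) : set A := center_of (CK_cycle C).

Definition cycle_subspace (C : seq (edge G)) : set A :=
  [set \sum_(p \in Arr (cycle_vert C)) (path_elt p ** z ** (path_elt p)^†)
     | z in center_cycle C].

End CuntzKrieger.

(* Main.v *)
(** A central element [y] satisfies [y P_v = sum_(s(e) = v) S_e (y P_(r(e))) S_e^*],
    so it is determined by the elements [y P_v] with [v] a sink or a vertex on a
    cycle.  For a sink, [P_v A P_v = C P_v].  For a cycle with an exit, based at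
    [v], the product [c] of its edges is a non-unitary isometry of the corner
    [P_v A P_v], and [y P_v] commutes with [c] and is a limit of Laurent
    polynomials in [c] and [c^*]; a Toeplitz argument shows that [y P_v] is a
    scalar multiple of [P_v].  This needs every [P_v] to be nonzero, which is
    read off from a Cuntz-Krieger family on an l^2-space.  For a cycle without
    exit that is not finitary, some cycle upstream has an exit, so [y P_v] is
    again scalar.  In the scalar case the set [W] of all [w] with
    [y P_w = a P_w] is hereditary and finitary and [y e(W) = a e(W)]; for a
    finitary NE-cycle [C], [y e(V(C))] lies in the subspace of [C].
    Replacing [y] by [y (1 - e(W))] for finitely many such [W] reduces [y] to
    an element that vanishes at all sinks and cycles, hence is [0]. *)

Require Import Defs.
From HB Require Import structures.
From mathcomp Require Import all_boot all_order all_algebra.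
From mathcomp Require Import complex.
From mathcomp Require Import all_classical all_reals all_analysis.
From mathcomp Require Import ring lra zify.

Set Implicit Arguments.
Unset Strict Implicit.
Unset Printing Implicit Defensive.

Import Order.TTheory GRing.Theory Num.Theory.
Import numFieldNormedType.Exports.

Local Open Scope classical_set_scope.
Local Open Scope ring_scope.
Local Open Scope cstar_scope.

(** [is_CK_algebra] describes A by a universal property, which can show an element to be nonzero
    only through a map into some concrete C*-algebra. This is why operators on a Hilbert space are
    constructed at all. The universal property is used once, for [P v != 0]; everything else rests
    on the Cuntz-Krieger relations and on generation. The obstacle is that y P_v is merely a norm
    limit of Laurent polynomials in c, whose coefficients have no evident limits. Neither a gauge
    action nor spectral theory is invoked. As c is a proper isometry, its defect projection reads
    each coefficient of p(c) off by contractions, which controls the coefficients of all powers of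
    p. For self-adjoint y the C*-identity gives |y^(2^m)| = |y|^(2^m), and the two growth rates
    collide. *)

(** * Hilbert spaces *)

(* [hip] is the real part of the complex inner product; by [hipJ] it determines
   the latter. *)
Record hilbert (R : realType) := Hilbert {
  hcar :> lmodType R[i];
  hip : hcar -> hcar -> R;
  hipC : forall x y, hip x y = hip y x;
  hipDl : forall x y z, hip (x + y) z = hip x z + hip y z;
  hipZl : forall (a : R) x y, hip (a%:C%C *: x) y = a * hip x y;
  hipJ : forall (a : R[i]) x y, hip (a *: x) y = hip x (a^* *: y);
  hip_ge0 : forall x, 0 <= hip x x;
  hip_eq0 : forall x, hip x x = 0 -> x = 0;
  hcomplete : forall F : set_system hcar, ProperFilter F ->
    (forall e : R, 0 < e -> exists x, F [set y | hip (y - x) (y - x) <= e]) ->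
    exists l, forall e : R, 0 < e -> F [set y | hip (y - l) (y - l) <= e]
}.

Section HilbertTheory.
Context {R : realType} {H : hilbert R}.
Implicit Types x y z : H.
Local Notation ip := (@hip R H).

Definition hnorm x := Num.sqrt (ip x x).

Lemma hipDr x y z : ip x (y + z) = ip x y + ip x z.
Proof. by rewrite hipC hipDl !(hipC x). Qed.

Lemma hipZr (a : R) x y : ip x (a%:C%C *: y) = a * ip x y.
Proof. by rewrite hipC hipZl hipC. Qed.

Lemma hipNl x y : ip (- x) y = - ip x y.
Proof. by rewrite -[- x]scaleN1r -(rmorphN1 (real_complex R)) hipZl mulN1r. Qed.

Lemma hipNr x y : ip x (- y) = - ip x y.
Proof. by rewrite hipC hipNl hipC. Qed.

Lemma hipBl x y z : ip (x - y) z = ip x z - ip y z.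
Proof. by rewrite hipDl hipNl. Qed.

Lemma hipBr x y z : ip x (y - z) = ip x y - ip x z.
Proof. by rewrite hipDr hipNr. Qed.

Lemma hip0l x : ip 0 x = 0.
Proof. by have := hipBl 0 0 x; rewrite !subrr. Qed.

Lemma hip_nondeg x : (forall y, ip x y = 0) -> x = 0.
Proof. by move=> /(_ x)/hip_eq0. Qed.

Lemma hnorm_ge0 x : 0 <= hnorm x. Proof. exact: sqrtr_ge0. Qed.

Lemma hnorm_sqr x : hnorm x ^+ 2 = ip x x.
Proof. by rewrite sqr_sqrtr ?hip_ge0. Qed.

Lemma hnorm0 : hnorm 0 = 0. Proof. by rewrite /hnorm hip0l sqrtr0. Qed.

Lemma hnorm_eq0 x : hnorm x = 0 -> x = 0.
Proof. by move=> h; apply: hip_eq0; rewrite -hnorm_sqr h expr0n. Qed.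

Lemma hnormN x : hnorm (- x) = hnorm x.
Proof. by rewrite /hnorm hipNl hipNr opprK. Qed.

Lemma hip_scale (a : R[i]) x :
  ip (a *: x) (a *: x) = (complex.Re a ^+ 2 + complex.Im a ^+ 2) * ip x x.
Proof.
rewrite hipJ scalerA hipC.
have -> : a^* * a = (complex.Re a ^+ 2 + complex.Im a ^+ 2)%:C%C.
  by case: a => a b; rewrite /Num.conj/=; simpc; congr (_ +i* _)%C; ring.
by rewrite hipZl.
Qed.

Lemma hnormZ (a : R[i]) x : (hnorm (a *: x))%:C%C = `|a| * (hnorm x)%:C%C.
Proof.
rewrite /hnorm hip_scale sqrtrM ?addr_ge0 ?sqr_ge0// normc_def.
by rewrite -rmorphM.
Qed.

Lemma hnormZr (a : R) x : hnorm (a%:C%C *: x) = `|a| * hnorm x.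
Proof. by rewrite /hnorm hip_scale /= expr0n addr0 sqrtrM ?sqr_ge0// sqrtr_sqr. Qed.

Lemma cauchy_schwarz x y : ip x y <= hnorm x * hnorm y.
Proof.
have [x0|x0] := eqVneq (hnorm x) 0.
  by rewrite (hnorm_eq0 x0) hip0l hnorm0 mul0r.
have [y0|y0] := eqVneq (hnorm y) 0.
  by rewrite (hnorm_eq0 y0) hipC hip0l hnorm0 mulr0.
have xp : 0 < hnorm x by rewrite lt_def x0 hnorm_ge0.
have yp : 0 < hnorm y by rewrite lt_def y0 hnorm_ge0.
(* With a = |x| and b = |y|, expanding <u, u> >= 0 gives 2 a b (a b - <x, y>) >= 0. *)
pose u := (hnorm y)%:C%C *: x - (hnorm x)%:C%C *: y.
have := hip_ge0 u.
rewrite /u hipBl !hipBr !(hipZl, hipZr) -!hnorm_sqr (hipC y x) => h.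
have : 2 * (hnorm x * hnorm y) * ip x y <= 2 * (hnorm x * hnorm y) * (hnorm x * hnorm y).
  by rewrite -subr_ge0; apply: le_trans h _; rewrite le_eqVlt; apply/orP; left; apply/eqP; ring.
by rewrite ler_pM2l// mulr_gt0// mulr_gt0.
Qed.

Lemma hnormD x y : hnorm (x + y) <= hnorm x + hnorm y.
Proof.
rewrite -(@ler_pXn2r _ 2)// ?nnegrE ?addr_ge0 ?hnorm_ge0//.
rewrite hnorm_sqr hipDl !hipDr (hipC y x) sqrrD !hnorm_sqr.
rewrite -!addrA lerD2l !addrA lerD2r -mulr2n.
by rewrite lerMn2r/= cauchy_schwarz.
Qed.

Lemma hip_le (M : R) x : 0 <= M -> (hnorm x <= M) = (ip x x <= M ^+ 2).
Proof. by move=> M0; rewrite -hnorm_sqr ler_pXn2r// ?nnegrE ?hnorm_ge0. Qed.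

Lemma hcomplete_norm (F : set_system H) : ProperFilter F ->
  (forall e : R, 0 < e -> exists x, F [set y | hnorm (y - x) <= e]) ->
  exists l, forall e : R, 0 < e -> F [set y | hnorm (y - l) <= e].
Proof.
move=> FF h; have [e e0|l lP] := @hcomplete _ H F FF.
  have s0 : 0 < Num.sqrt e by rewrite sqrtr_gt0.
  have [x xP] := h _ s0; exists x; apply: filterS xP => y /=.
  by rewrite hip_le ?sqrtr_ge0// sqr_sqrtr// ltW.
exists l => e e0; have e2 : 0 < e ^+ 2 by rewrite exprn_gt0.
by apply: filterS (lP _ e2) => y /=; rewrite (hip_le _ (ltW e0)).
Qed.

End HilbertTheory.

(** * The C*-algebra of bounded operators on a Hilbert space *)

Section BoundedOperators.
Context {R : realType} (H : hilbert R).
Local Notation ip := (@hip R H).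

(** Demanding an adjoint replaces the Riesz representation theorem; the price is that completeness
    must also produce the adjoint of a limit. As [hip] determines the complex inner product, T' is
    the usual adjoint. *)
Definition bop (T : H -> H) : Prop :=
  [/\ linear T,
      exists M : R, forall x, hnorm (T x) <= M * hnorm x &
      exists T' : H -> H, forall x y, ip (T x) y = ip x (T' y)].

Definition bop_pred : {pred (H -> H)} := fun T => `[< bop T >].

Record BH := MkBH { bfun :> H -> H; bfun_bop : bfun \in bop_pred }.

HB.instance Definition _ := [isSub for bfun].
HB.instance Definition _ := [Choice of BH by <:].

Lemma bop_submod_closed : submod_closed bop_pred.
Proof.
split.
  apply/asboolP; split.
  - by move=> a x y; change ((0 : H) = a *: 0 + 0); rewrite scaler0 addr0.
  - by exists 0 => x; rewrite mul0r -[(_ : H -> H) x]/(0 : H) hnorm0.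
  - by exists (fun=> 0) => x y; rewrite -[(_ : H -> H) x]/(0 : H) hip0l hipC hip0l.
move=> a T U /asboolP[Tl [M TM] [T' TT']] /asboolP[Ul [N UN] [U' UU']].
apply/asboolP; split.
- move=> b x y; change (a *: T (b *: x + y) + U (b *: x + y) =
    b *: (a *: T x + U x) + (a *: T y + U y)).
  rewrite Tl Ul !scalerDr !scalerA (mulrC b a).
  by rewrite -!addrA; congr (_ + _); rewrite !addrA; congr (_ + _); rewrite addrC.
- have [c ac] : exists c : R, `|a| = c%:C%C by rewrite normc_def; eexists.
  have c0 : 0 <= c by rewrite -ler0c -ac.
  exists (c * M + N) => x; apply: le_trans (hnormD _ _) _.
  rewrite mulrDl; apply: lerD => //.
  have -> : hnorm (a *: T x) = c * hnorm (T x).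
    by apply: complexI; rewrite hnormZ ac rmorphM.
  by rewrite -mulrA ler_wpM2l.
- exists (fun y => T' (a^* *: y) + U' y) => x y.
  by rewrite -[(_ : H -> H) x]/(a *: T x + U x) hipDl hipDr hipJ TT' UU'.
Qed.

HB.instance Definition _ := GRing.isSubmodClosed.Build _ _ bop_pred
  bop_submod_closed.
HB.instance Definition _ := [SubChoice_isSubLmodule of BH by <:].

Implicit Types T U : BH.

Lemma bopP T : bop T. Proof. exact/asboolP/bfun_bop. Qed.

Lemma BHP T U : (forall x, T x = U x) -> T = U.
Proof. by move=> h; apply/val_inj/funext. Qed.

Lemma BHl T : linear T. Proof. by case: (bopP T). Qed.
Lemma BHD T U x : (T + U) x = T x + U x. Proof. by []. Qed.
Lemma BHB T U x : (T - U) x = T x - U x. Proof. by []. Qed.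
Lemma BHZ (a : R[i]) T x : (a *: T) x = a *: T x. Proof. by []. Qed.

Lemma BH_0 T : T 0 = 0.
Proof. by have := BHl T (-1) 0 0; rewrite scaler0 addr0 scaleN1r addNr. Qed.

Lemma BH_scale T a x : T (a *: x) = a *: T x.
Proof. by have := BHl T a x 0; rewrite !addr0 BH_0 addr0.
Qed.

Definition badj_fun T : H -> H := let: And3 _ _ h := bopP T in projT1 (cid h).

Lemma badj_funP T x y : ip (T x) y = ip x (badj_fun T y).
Proof. by rewrite /badj_fun; case: (bopP T) => _ _ h; case: cid. Qed.

Lemma ip_inj x y : (forall z, ip z x = ip z y) -> x = y.
Proof.
move=> h; apply/eqP; rewrite -subr_eq0; apply/eqP/hip_nondeg => z.
by rewrite hipC hipBr h subrr.
Qed.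

Definition opnorm T : R := sup [set hnorm (T x) | x in [set x : H | hnorm x <= 1]].

Lemma opnorm_has_sup T :
  has_sup [set hnorm (T x) | x in [set x : H | hnorm x <= 1]].
Proof.
split; first by exists (hnorm (T 0)), 0 => //=; rewrite hnorm0 ler01.
have [_ [M TM] _] := bopP T.
exists `|M| => _ [x /= x1 <-]; apply: le_trans (TM x) _.
apply: (@le_trans _ _ (`|M| * hnorm x)); first by rewrite ler_wpM2r ?hnorm_ge0// ler_norm.
by rewrite -[leRHS]mulr1 ler_wpM2l.
Qed.

Lemma opnorm_ge0 T : 0 <= opnorm T.
Proof.
apply: le_trans (hnorm_ge0 (T 0)) _; apply: sup_upper_bound; first exact: opnorm_has_sup.
by exists 0 => //=; rewrite hnorm0 ler01.
Qed.

Lemma opnormP T x : hnorm (T x) <= opnorm T * hnorm x.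
Proof.
have [x0|x0] := eqVneq (hnorm x) 0.
  have -> : T x = 0 by rewrite (hnorm_eq0 x0) BH_0.
  by rewrite x0 mulr0 hnorm0.
have xp : 0 < hnorm x by rewrite lt_def x0 hnorm_ge0.
rewrite -ler_pdivrMr//.
have -> : hnorm (T x) / hnorm x = hnorm (T ((hnorm x)^-1%:C%C *: x)).
  by rewrite BH_scale hnormZr ger0_norm ?invr_ge0 ?hnorm_ge0// mulrC.
apply: sup_upper_bound; first exact: opnorm_has_sup.
exists ((hnorm x)^-1%:C%C *: x) => //=.
by rewrite hnormZr ger0_norm ?invr_ge0 ?hnorm_ge0// mulVf.
Qed.

Lemma opnorm_le T (M : R) : 0 <= M ->
  (forall x, hnorm (T x) <= M * hnorm x) -> opnorm T <= M.
Proof.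
move=> M0 h; apply: ge_sup; first by have [] := opnorm_has_sup T.
move=> _ [x /= x1 <-]; apply: le_trans (h x) _.
by rewrite -[leRHS]mulr1 ler_wpM2l.
Qed.

(** Cancel |T^* x| in |T^* x|^2 = <T T^* x, x> <= |T| |T^* x| |x|. *)
Lemma badj_bound T x : hnorm (badj_fun T x) <= opnorm T * hnorm x.
Proof.
have [x0|x0] := eqVneq (hnorm (badj_fun T x)) 0.
  by rewrite x0 mulr_ge0 ?opnorm_ge0 ?hnorm_ge0.
have xp : 0 < hnorm (badj_fun T x) by rewrite lt_def x0 hnorm_ge0.
rewrite -(ler_pM2l xp) -expr2 hnorm_sqr -badj_funP.
apply: le_trans (cauchy_schwarz _ _) _.
by rewrite mulrA ler_wpM2r ?hnorm_ge0// mulrC opnormP.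
Qed.

Lemma badj_bop T : badj_fun T \in bop_pred.
Proof.
apply/asboolP; split.
- move=> a x y; apply: ip_inj => z.
  rewrite -badj_funP !hipDr; congr (_ + _); last exact: badj_funP.
  have Jr u w : ip u (a *: w) = ip (a^* *: u) w by rewrite hipC hipJ hipC.
  by rewrite !Jr -BH_scale badj_funP.
- by exists (opnorm T) => x; exact: badj_bound.
- by exists T => x y; rewrite hipC -badj_funP hipC.
Qed.

Definition badj T : BH := MkBH (badj_bop T).

Lemma badjP T x y : ip (T x) y = ip x (badj T y).
Proof. exact: badj_funP. Qed.

Lemma comp_bop T U : (fun x => T (U x)) \in bop_pred.
Proof.
apply/asboolP; split.
- by move=> a x y /=; rewrite !BHl.
- exists (opnorm T * opnorm U) => x; apply: le_trans (opnormP _ _) _.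
  by rewrite -mulrA ler_wpM2l ?opnorm_ge0 ?opnormP.
- by exists (fun y => badj U (badj T y)) => x y; rewrite !badjP.
Qed.

Definition bmul T U : BH := MkBH (comp_bop T U).

Lemma badj_uniq T U : (forall x y, ip (T x) y = ip x (U y)) -> badj T = U.
Proof. by move=> h; apply: BHP => y; apply: ip_inj => z; rewrite -badjP h. Qed.

Lemma badjK : involutive badj.
Proof. by move=> T; apply: badj_uniq => x y; rewrite hipC -badjP hipC. Qed.

Lemma opnorm_badj T : opnorm (badj T) <= opnorm T.
Proof. by apply: opnorm_le => [|x]; [exact: opnorm_ge0 | exact: badj_bound]. Qed.

Lemma opnormD T U : opnorm (T + U) <= opnorm T + opnorm U.
Proof.
apply: opnorm_le => [|x]; first by rewrite addr_ge0 ?opnorm_ge0.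
by rewrite BHD mulrDl; apply: le_trans (hnormD _ _) _; rewrite lerD ?opnormP.
Qed.

Definition bnorm T : R[i] := (opnorm T)%:C%C.

Lemma bnormD T U : bnorm (T + U) <= bnorm T + bnorm U.
Proof. by rewrite /bnorm -rmorphD/= lecR opnormD. Qed.

Lemma bnormZ (a : R[i]) T : bnorm (a *: T) = `|a| * bnorm T.
Proof.
have [c ac] : exists c : R, `|a| = c%:C%C by rewrite normc_def; eexists.
have c0 : 0 <= c by rewrite -ler0c -ac.
have E x : hnorm (a *: T x) = c * hnorm (T x).
  by apply: complexI; rewrite hnormZ ac rmorphM.
rewrite /bnorm ac -rmorphM; congr (_%:C%C); apply/eqP; rewrite eq_le; apply/andP; split.
  apply: opnorm_le => [|x]; first by rewrite mulr_ge0 ?opnorm_ge0.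
  by rewrite BHZ E -mulrA ler_wpM2l ?opnormP.
have [->|cN] := eqVneq c 0; first by rewrite mul0r opnorm_ge0.
have cp : 0 < c by rewrite lt_def cN.
rewrite mulrC -ler_pdivlMr//; apply: opnorm_le => [|x].
  by rewrite divr_ge0 ?opnorm_ge0.
rewrite mulrAC ler_pdivlMr// mulrC -E -BHZ; exact: opnormP.
Qed.

Lemma bnorm0_eq0 T : bnorm T = 0 -> T = 0.
Proof.
move=> /complexI T0; apply: BHP => x; apply: hnorm_eq0; apply/eqP.
by rewrite eq_le hnorm_ge0 andbT; have := opnormP T x; rewrite T0 mul0r.
Qed.

HB.instance Definition _ := Lmodule_isNormed.Build R[i] BH bnormD bnormZ bnorm0_eq0.

End BoundedOperators.

(** * Completeness and the C*-identity for bounded operators *)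

Section BoundedOperatorsComplete.
Context {R : realType} (H : hilbert R).
Local Notation ip := (@hip R H).
Local Notation B := (BH H).
Implicit Types T U : B.

Lemma BH_normE T : `|T| = (opnorm T)%:C%C. Proof. by []. Qed.

Lemma le0_eps (a : R) (K : R) : 0 <= K -> (forall e, 0 < e -> a <= e * K) -> a <= 0.
Proof.
move=> K0 h; rewrite leNgt; apply/negP => a0.
have K1 : 0 < K + 1 by rewrite ltr_wpDl.
have e0 : 0 < a / (K + 1) by rewrite divr_gt0.
have := h _ e0; rewrite leNgt => /negP; apply.
by rewrite mulrAC ltr_pdivrMr// ltr_pM2l// ltrDl.
Qed.

Lemma BH_cauchy (F : set_system B) : ProperFilter F -> cauchy F ->
  forall e : R, 0 < e -> exists T0, F [set T | opnorm (T - T0) <= e].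
Proof.
move=> FF /cauchyP Fc e e0.
have ec : 0 < e%:C%C :> R[i] by rewrite ltcR.
have [T0 T0P] := Fc _ ec; exists T0; apply: filterS T0P => T.
rewrite -ball_normE /= => h; have {}h : `|T0 - T| < e%:C%C := h.
by move: h; rewrite distrC BH_normE ltcR => /ltW.
Qed.

(** The limit is taken pointwise, both for the operators and for their adjoints; the second limit is
    the adjoint of the first. *)
Lemma BH_complete (F : set_system B) : ProperFilter F -> cauchy F -> cvg F.
Proof.
move=> FF /BH_cauchy Fc.
have lim_ex (f : B -> H -> H) x :
    (forall T T0, hnorm (f T x - f T0 x) <= opnorm (T - T0) * hnorm x) ->
    exists l, forall e : R, 0 < e -> F [set T | hnorm (f T x - l) <= e].
  move=> fP.
  have [e e0|l lP] := @hcomplete_norm _ H ((fun T => f T x) @ F) _.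
    have e'0 : 0 < e / (hnorm x + 1) by rewrite divr_gt0// ltr_wpDl ?hnorm_ge0.
    have [T0 T0P] := Fc _ e'0; exists (f T0 x).
    suff : F [set T | hnorm (f T x - f T0 x) <= e] by [].
    apply: filterS T0P => T /= h.
    apply: le_trans (fP _ _) _.
    apply: (@le_trans _ _ (e / (hnorm x + 1) * hnorm x)).
      by rewrite ler_wpM2r ?hnorm_ge0.
    rewrite mulrAC ler_pdivrMr ?ltr_wpDl ?hnorm_ge0//.
    by rewrite ler_pM2l// lerDl.
  by exists l.
have adjB T T0 : badj (T - T0) = badj T - badj T0.
  by apply: badj_uniq => x y; rewrite BHB hipBl !badjP -hipBr.
have /choice[L LP] : forall x, exists l, forall e : R, 0 < e ->
    F [set T | hnorm (T x - l) <= e].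
  by move=> x; apply: (lim_ex (fun T => T)) => T T0; rewrite -BHB opnormP.
have /choice[L' LP'] : forall x, exists l, forall e : R, 0 < e ->
    F [set T | hnorm (badj T x - l) <= e].
  move=> x; apply: (lim_ex (fun T => badj T)) => T T0; rewrite -BHB -adjB.
  exact: badj_bound.
(* The Cauchy estimate survives the pointwise limit with the same d. It yields both the boundedness
   of L and convergence in operator norm. *)
have close T0 (d : R) : F [set T | opnorm (T - T0) <= d] ->
    forall x, hnorm (L x - T0 x) <= d * hnorm x.
  move=> FT0 x; rewrite -subr_le0; apply: (@le0_eps _ 1) => // e e0.
  have [T [/= h1 h2]] := filter_ex (filterI FT0 (LP x _ e0)).
  rewrite mulr1 lerBlDr.
  have -> : L x - T0 x = (L x - T x) + (T - T0) x by rewrite BHB subrKA.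
  apply: le_trans (hnormD _ _) (lerD _ _).
    by rewrite -hnormN opprB.
  by apply: le_trans (opnormP _ _) _; rewrite ler_wpM2r ?hnorm_ge0.
have Lbop : L \in @bop_pred R H.
  apply/asboolP; split.
  - move=> a x y; apply/eqP; rewrite -subr_eq0; apply/eqP/hnorm_eq0/le_anti.
    rewrite hnorm_ge0 andbT.
    have [c ac] : exists c : R, `|a| = c%:C%C by rewrite normc_def; eexists.
    have c0 : 0 <= c by rewrite -ler0c -ac.
    have E w : hnorm (a *: w) = c * hnorm w.
      by apply: complexI; rewrite hnormZ ac rmorphM.
    apply: (@le0_eps _ (1 + (c + 1))) => [|e e0]; first by rewrite !addr_ge0.
    have [T [/= h1 [/= h2 h3]]] := filter_ex (filterI (LP (a *: x + y) _ e0)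
      (filterI (LP x _ e0) (LP y _ e0))).
    have -> : L (a *: x + y) - (a *: L x + L y) =
       - (T (a *: x + y) - L (a *: x + y)) + (a *: (T x - L x) + (T y - L y)).
      by rewrite BHl scalerBr opprB -addrA (addrACA (a *: T x)) addKr opprD.
    rewrite mulrDr mulr1 mulrDr mulr1.
    apply: le_trans (hnormD _ _) (lerD _ _); first by rewrite hnormN.
    apply: le_trans (hnormD _ _) (lerD _ _) => //.
    by rewrite E mulrC ler_wpM2r.
  - have [T0 T0P] := Fc 1 ltr01; exists (1 + opnorm T0) => x.
    rewrite -[L x](subrK (T0 x)) mulrDl.
    apply: le_trans (hnormD _ _) (lerD _ (opnormP _ _)).
    exact: close.
  - exists L' => x y; apply/eqP; rewrite -subr_eq0 -normr_le0.
    apply: (@le0_eps _ (hnorm y + hnorm x)) => [|e e0].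
      by rewrite addr_ge0 ?hnorm_ge0.
    have [T [/= h1 h2]] := filter_ex (filterI (LP x _ e0) (LP' y _ e0)).
    have -> : ip (L x) y - ip x (L' y) =
        - ip (T x - L x) y + ip x (badj T y - L' y).
      by rewrite hipBl hipBr badjP opprB addrA subrK.
    have CS u w : `|ip u w| <= hnorm u * hnorm w.
      rewrite ler_norml cauchy_schwarz andbT lerNl -hipNl -(hnormN u).
      exact: cauchy_schwarz.
    rewrite mulrDr; apply: le_trans (ler_normD _ _) (lerD _ _).
      rewrite normrN; apply: le_trans (CS _ _) _.
      by rewrite ler_wpM2r ?hnorm_ge0.
    apply: le_trans (CS _ _) _.
    by rewrite mulrC ler_wpM2r ?hnorm_ge0.
pose LB : B := MkBH Lbop.
apply/cvg_ex; exists LB; apply/cvgrPdist_le => /= e e0.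
(* Norms take values in R[i], where a positive element is necessarily real. *)
have [r r0 ->] : exists2 r : R, 0 < r & e = r%:C%C.
  have /complex_realP[r er] := gtr0_real e0.
  by exists r; rewrite -?ltcR -?er.
have r20 : 0 < r / 2 by rewrite divr_gt0.
have [T0 T0P] := Fc _ r20.
apply: filterS (T0P) => T /= h.
have {}h : opnorm (T - T0) <= r / 2 := h.
rewrite distrC BH_normE lecR; apply: opnorm_le => [|x]; first exact: ltW.
have -> : (T - LB) x = (T - T0) x + - (L x - T0 x) by rewrite !BHB opprB addrA subrK.
rewrite [r]splitr mulrDl.
apply: le_trans (hnormD _ _) (lerD _ _).
  by apply: le_trans (opnormP _ _) _; rewrite ler_wpM2r ?hnorm_ge0.
by rewrite hnormN; exact: close.
Qed.

HB.instance Definition _ := Uniform_isComplete.Build B BH_complete.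

Lemma bmulA : associative (@bmul R H). Proof. by move=> *; apply: BHP. Qed.

Lemma bmulDl : left_distributive (@bmul R H) +%R.
Proof. by move=> *; apply: BHP. Qed.

Lemma bmulDr : right_distributive (@bmul R H) +%R.
Proof.
move=> T U V; apply: BHP => x.
by have E := BHl T 1 (U x) (V x); rewrite !scale1r in E; exact: E.
Qed.

Lemma bmulZl (a : R[i]) T U : bmul (a *: T) U = a *: bmul T U.
Proof. exact: BHP. Qed.

Lemma bmulZr (a : R[i]) T U : bmul T (a *: U) = a *: bmul T U.
Proof. by apply: BHP => x; exact: (BH_scale T a (U x)). Qed.

Lemma badjD : {morph @badj R H : T U / T + U}.
Proof. by move=> T U; apply: badj_uniq => x y; rewrite hipDl !badjP -hipDr. Qed.

Lemma badjZ (a : R[i]) T : badj (a *: T) = a^* *: badj T.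
Proof.
by apply: badj_uniq => x y; rewrite BHZ hipJ badjP BHZ BH_scale.
Qed.

Lemma badjM T U : badj (bmul T U) = bmul (badj U) (badj T).
Proof.
apply: badj_uniq => x y; change (ip (T (U x)) y = ip x (badj U (badj T y))).
by rewrite !badjP.
Qed.

Lemma bnormM T U : `|bmul T U| <= `|T| * `|U|.
Proof.
rewrite !BH_normE -rmorphM lecR; apply: opnorm_le => [|x].
  by rewrite mulr_ge0 ?opnorm_ge0.
apply: le_trans (opnormP T (U x)) _.
by rewrite -mulrA ler_wpM2l ?opnorm_ge0 ?opnormP.
Qed.

(** One inequality is submultiplicativity with |T^*| <= |T|; the other comes from |T x|^2 = <x, T^*
    T x> <= |T^* T| |x|^2. *)
Lemma bnorm_cstar T : `|bmul (badj T) T| = `|T| ^+ 2.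
Proof.
rewrite !BH_normE -rmorphXn; congr (_%:C%C); apply/eqP; rewrite eq_le; apply/andP; split.
  have := bnormM (badj T) T; rewrite !BH_normE -rmorphM lecR => /le_trans; apply.
  by rewrite expr2 ler_wpM2r ?opnorm_ge0 ?opnorm_badj.
set N := opnorm (bmul _ _).
have N0 : 0 <= N by exact: opnorm_ge0.
rewrite -[leRHS]sqr_sqrtr// ler_pXn2r ?nnegrE ?opnorm_ge0 ?sqrtr_ge0//.
apply: opnorm_le => [|x]; first exact: sqrtr_ge0.
rewrite -(@ler_pXn2r _ 2) ?nnegrE ?hnorm_ge0 ?mulr_ge0 ?sqrtr_ge0 ?hnorm_ge0//.
rewrite hnorm_sqr badjP -/(bmul (badj T) T x) exprMn sqr_sqrtr// expr2 mulrA mulrC.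
apply: le_trans (cauchy_schwarz _ _) _; rewrite ler_wpM2l ?hnorm_ge0//.
exact: (opnormP (bmul (badj T) T)).
Qed.

HB.instance Definition _ := isCStarAlgebra.Build R B bmulA bmulDl bmulDr
  bmulZl bmulZr badjD badjZ badjM (@badjK R H) bnormM bnorm_cstar.

End BoundedOperatorsComplete.

(** * Square-summable families *)

Section SquareSummable.
Context {R : realType} (I : finType).
Local Notation C := R[i].
Local Notation F := (I -> nat -> C).
Implicit Types x y : F.

(** The real part of a times the conjugate of b. *)
Definition cdot (a b : C) : R :=
  complex.Re a * complex.Re b + complex.Im a * complex.Im b.

(** Partial sums carry the algebra: identities and bounds are proved at each n, and limits are taken
    only afterwards. *)
Definition pdot x y (n : nat) : R := \sum_(0 <= k < n) \sum_i cdot (x i k) (y i k).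

Lemma cdotC a b : cdot a b = cdot b a.
Proof. by rewrite /cdot; congr (_ + _); exact: mulrC. Qed.

Lemma cdotDl a b c : cdot (a + b) c = cdot a c + cdot b c.
Proof. by case: a b c => [? ?] [? ?] [? ?]; rewrite /cdot /=; ring. Qed.

Lemma cdotZl (r : R) a b : cdot (r%:C%C * a) b = r * cdot a b.
Proof. by case: a b => [? ?] [? ?]; rewrite /cdot /=; ring. Qed.

Lemma cdotJ c a b : cdot (c * a) b = cdot a (c^* * b).
Proof. by case: a b c => [? ?] [? ?] [? ?]; rewrite /cdot /Num.conj /=; ring. Qed.

Lemma cdot_ge0 a : 0 <= cdot a a.
Proof. by rewrite /cdot -!expr2 addr_ge0 ?sqr_ge0. Qed.

Lemma cdot_eq0 a : cdot a a = 0 -> a = 0.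
Proof.
case: a => a b; rewrite /cdot /= -!expr2 => /eqP.
by rewrite paddr_eq0 ?sqr_ge0// !expf_eq0/= => /andP[/eqP-> /eqP->].
Qed.

Lemma pdotC x y n : pdot x y n = pdot y x n.
Proof. by apply: eq_bigr => k _; apply: eq_bigr => i _; exact: cdotC. Qed.

Lemma pdotDl x y z n : pdot (x + y) z n = pdot x z n + pdot y z n.
Proof.
rewrite /pdot -big_split; apply: eq_bigr => k _ /=.
by rewrite -big_split; apply: eq_bigr => i _; exact: cdotDl.
Qed.

Lemma pdotDr x y z n : pdot x (y + z) n = pdot x y n + pdot x z n.
Proof. by rewrite pdotC pdotDl !(pdotC _ x). Qed.

Lemma pdotZl (r : R) x y n : pdot (r%:C%C *: x) y n = r * pdot x y n.
Proof.
rewrite /pdot mulr_sumr; apply: eq_bigr => k _ /=.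
by rewrite mulr_sumr; apply: eq_bigr => i _; exact: cdotZl.
Qed.

Lemma pdotJ (c : C) x y n : pdot (c *: x) y n = pdot x (c^* *: y) n.
Proof. by apply: eq_bigr => k _; apply: eq_bigr => i _; exact: cdotJ. Qed.

Lemma pdot_ge0 x n : 0 <= pdot x x n.
Proof. by apply: sumr_ge0 => k _; apply: sumr_ge0 => i _; exact: cdot_ge0. Qed.

Lemma pdot_nd x : nondecreasing_seq (pdot x x).
Proof.
apply/nondecreasing_seqP => n; rewrite /pdot big_nat_recr//= lerDl.
by apply: sumr_ge0 => i _; exact: cdot_ge0.
Qed.

Lemma pdot_coord x i k n : (k < n)%N -> cdot (x i k) (x i k) <= pdot x x n.
Proof.
move=> kn; rewrite /pdot (bigD1_seq k) ?iota_uniq ?mem_index_iota//= (bigD1 i)//=.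
rewrite -addrA lerDl addr_ge0 ?sumr_ge0// => *; first exact: cdot_ge0.
by apply: sumr_ge0 => *; exact: cdot_ge0.
Qed.

Lemma pdot_parallelogram x y n :
  pdot (x + y) (x + y) n + pdot (x - y) (x - y) n = 2 * pdot x x n + 2 * pdot y y n.
Proof.
have Nl u v : pdot (- u) v n = - pdot u v n.
  by rewrite -scaleN1r -(rmorphN1 (real_complex R)) pdotZl mulN1r.
have Nr u v : pdot u (- v) n = - pdot u v n by rewrite pdotC Nl pdotC.
by rewrite !(pdotDl, pdotDr, Nl, Nr) (pdotC y x); ring.
Qed.

Definition l2_pred : {pred F} := fun x => `[< exists M, forall n, pdot x x n <= M >].

(** The parallelogram law bounds |c x + y|^2 by 2 |c x|^2 + 2 |y|^2 on every partial sum. *)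
Lemma l2_submod_closed : submod_closed l2_pred.
Proof.
split.
  apply/asboolP; exists 0 => n; rewrite /pdot big1// => k _; rewrite big1// => i _.
  by rewrite /cdot !mul0r addr0.
move=> c x y /asboolP[M xM] /asboolP[N yN]; apply/asboolP.
have cc : c^* * c = (complex.Re c ^+ 2 + complex.Im c ^+ 2)%:C%C.
  by case: c => a b; rewrite /Num.conj/=; simpc; congr (_ +i* _)%C; ring.
exists (2 * ((complex.Re c ^+ 2 + complex.Im c ^+ 2) * M) + 2 * N) => n.
have := pdot_parallelogram (c *: x) y n.
have := pdot_ge0 (c *: x - y) n.
have := xM n; have := yN n.
have -> : pdot (c *: x) (c *: x) n = (complex.Re c ^+ 2 + complex.Im c ^+ 2) * pdot x x n.
  by rewrite pdotJ scalerA cc pdotC pdotZl.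
have : 0 <= complex.Re c ^+ 2 + complex.Im c ^+ 2 by rewrite addr_ge0 ?sqr_ge0.
nra.
Qed.

HB.instance Definition _ := GRing.isSubmodClosed.Build _ _ l2_pred l2_submod_closed.

Record l2 := MkL2 { l2val :> F; l2valP : l2val \in l2_pred }.

HB.instance Definition _ := [isSub for l2val].
HB.instance Definition _ := [Choice of l2 by <:].
HB.instance Definition _ := [SubChoice_isSubLmodule of l2 by <:].

Implicit Types u v w : l2.

Lemma l2_bound u : exists M, forall n, pdot u u n <= M.
Proof. exact/asboolP/l2valP. Qed.

Lemma pdot_self_cvg u : cvgn (pdot u u).
Proof.
apply: nondecreasing_is_cvgn; first exact: pdot_nd.
by have [M uM] := l2_bound u; exists M => _ [n _ <-].
Qed.

(** Polarisation reduces mixed products to three self-products, whose partial sums are monotone and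
    bounded. *)
Lemma pdot_cvg u v : cvgn (pdot u v).
Proof.
have -> : pdot u v =
    (fun n => 2^-1 * (pdot (u + v : l2) (u + v : l2) n - pdot u u n - pdot v v n)).
  apply/funext => n; rewrite [l2val (_ + _)]/(l2val u + l2val v).
  by rewrite !(pdotDl, pdotDr) (pdotC v u); field.
apply: is_cvgM; first exact: is_cvg_cst.
by apply: is_cvgB; first apply: is_cvgB; exact: pdot_self_cvg.
Qed.

Definition l2ip u v : R := limn (pdot u v).

Lemma l2ip_cvg u v : pdot u v n @[n --> \oo] --> l2ip u v.
Proof. exact: pdot_cvg. Qed.

Lemma l2ipE u v (l : R) : pdot u v n @[n --> \oo] --> l -> l2ip u v = l.
Proof. by move=> h; apply: (cvg_lim _ h). Qed.

Lemma pdot_le_l2ip u n : pdot u u n <= l2ip u u.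
Proof. exact: (nondecreasing_cvgn_le (pdot_nd u) (@pdot_self_cvg u)). Qed.

Lemma l2ipC u v : l2ip u v = l2ip v u.
Proof. by rewrite /l2ip; congr (limn _); apply/funext => n; exact: pdotC. Qed.

Lemma l2ipDl u v w : l2ip (u + v) w = l2ip u w + l2ip v w.
Proof.
apply: l2ipE; rewrite [l2val (_ + _)]/(l2val u + l2val v).
under eq_fun do rewrite pdotDl.
by apply: cvgD; exact: l2ip_cvg.
Qed.

Lemma l2ipZl (r : R) u v : l2ip (r%:C%C *: u) v = r * l2ip u v.
Proof.
apply: l2ipE; rewrite [l2val (_ *: _)]/(r%:C%C *: l2val u).
under eq_fun do rewrite pdotZl.
by apply: cvgM; [exact: cvg_cst | exact: l2ip_cvg].
Qed.

Lemma l2ipJ (c : C) u v : l2ip (c *: u) v = l2ip u (c^* *: v).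
Proof.
rewrite /l2ip; congr (limn _); apply/funext => n.
rewrite [l2val (c *: _)]/(c *: l2val u) [l2val (c^* *: _)]/(c^* *: l2val v).
by rewrite pdotJ.
Qed.

Lemma l2ip_ge0 u : 0 <= l2ip u u.
Proof. exact: le_trans (pdot_ge0 u 0) (pdot_le_l2ip u 0). Qed.

Lemma l2_coord u i k : cdot (u i k) (u i k) <= l2ip u u.
Proof. exact: le_trans (pdot_coord _ _ (ltnSn k)) (pdot_le_l2ip _ _). Qed.

Lemma l2ip_eq0 u : l2ip u u = 0 -> u = 0.
Proof.
move=> u0; apply/val_inj/funext => i; apply/funext => k.
apply: cdot_eq0; apply/le_anti; rewrite cdot_ge0 andbT.
by have := l2_coord u i k; rewrite u0.
Qed.

Lemma l2ip_le u (M : R) : (forall n, pdot u u n <= M) -> l2ip u u <= M.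
Proof. by move=> h; apply: limr_le; [exact: pdot_self_cvg | exact: nearW]. Qed.

(** Real and imaginary parts of each coordinate converge in R. A bound on the full norm gives the
    same bound on each partial sum; being a finite sum, it passes to the coordinatewise limit. *)
Lemma l2_complete (A : set_system l2) : ProperFilter A ->
  (forall e : R, 0 < e -> exists u, A [set v | l2ip (v - u) (v - u) <= e]) ->
  exists l, forall e : R, 0 < e -> A [set v | l2ip (v - l) (v - l) <= e].
Proof.
move=> AF Ac.
have coord_cvg (f : C -> R) i k : (forall a b, f (a - b) = f a - f b) ->
    (forall a, f a ^+ 2 <= cdot a a) ->
    exists r : R, (fun v : l2 => f (v i k)) @ A --> r.
  move=> fB fle; apply/cvg_ex; apply: R_complete; apply: cauchy_exP => e e0.
  have e20 : 0 < (e / 2) ^+ 2 by rewrite exprn_gt0// divr_gt0.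
  have [u uA] := Ac _ e20; exists (f (u i k)).
  suff : A [set v | `|f (u i k) - f (v i k)| < e] by [].
  apply: filterS uA => v /= h.
  apply: (@le_lt_trans _ _ (e / 2)); last by rewrite ltr_pdivrMr// ltr_pMr// ltr1n.
  rewrite distrC -(@ler_pXn2r _ 2)// ?nnegrE ?divr_ge0 ?(ltW e0)//.
  rewrite real_normK ?num_real// -fB; apply: le_trans h.
  exact: le_trans (fle _) (l2_coord (v - u) i k).
have ReP i : forall k, exists r : R, (fun v : l2 => complex.Re (v i k)) @ A --> r.
  move=> k; apply: coord_cvg => [[a b] [c d]//|[a b]].
  by rewrite /cdot /= -!expr2 lerDl sqr_ge0.
have ImP i : forall k, exists r : R, (fun v : l2 => complex.Im (v i k)) @ A --> r.
  move=> k; apply: coord_cvg => [[a b] [c d]//|[a b]].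
  by rewrite /cdot /= -!expr2 lerDr sqr_ge0.
have /choice[lr lrP] : forall i, exists r : nat -> R,
    forall k, (fun v : l2 => complex.Re (v i k)) @ A --> r k by move=> i; have [f fP] := choice (ReP i); exists f.
have /choice[li liP] : forall i, exists r : nat -> R,
    forall k, (fun v : l2 => complex.Im (v i k)) @ A --> r k by move=> i; have [f fP] := choice (ImP i); exists f.
pose l : F := fun i k => (lr i k +i* li i k)%C.
have close u (e : R) : A [set v | l2ip (v - u) (v - u) <= e] ->
    forall n, pdot (l - l2val u) (l - l2val u) n <= e.
  move=> uA n.
  have cv : (fun v : l2 => pdot (l2val v - l2val u) (l2val v - l2val u) n) @ A -->
      pdot (l - l2val u) (l - l2val u) n.
    apply: cvg_big => [|k _]; first exact: add_continuous.
    apply: cvg_big => [|i _]; first exact: add_continuous.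
    have ReB (a b : C) : complex.Re (a - b) = complex.Re a - complex.Re b.
      by case: a b => [? ?] [? ?].
    have ImB (a b : C) : complex.Im (a - b) = complex.Im a - complex.Im b.
      by case: a b => [? ?] [? ?].
    have E (a b : C) : cdot (a - b) (a - b) =
       (complex.Re a - complex.Re b) * (complex.Re a - complex.Re b) +
       (complex.Im a - complex.Im b) * (complex.Im a - complex.Im b).
      by rewrite /cdot ReB ImB.
    rewrite [cdot _ _]E; under eq_fun do rewrite [cdot _ _]E.
    by apply: cvgD; apply: cvgM; apply: cvgB; (exact: cvg_cst || exact: lrP || exact: liP).
  rewrite -(cvg_lim _ cv)//; apply: limr_le; first by apply/cvg_ex; eexists; exact: cv.
  apply: filterS uA => v /=; apply: le_trans.
  exact: (pdot_le_l2ip (v - u)).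
have lP : l \in l2_pred.
  have [u uA] := Ac 1 ltr01.
  rewrite -(subrK (l2val u) l) rpredD//; last exact: l2valP.
  by apply/asboolP; exists 1; exact: close.
exists (MkL2 lP) => e e0.
(* The parallelogram law doubles both squared distances: 2 (e / 4) + 2 (e / 4) = e. *)
have e40 : 0 < e / 4 by rewrite divr_gt0.
have [u uA] := Ac _ e40; apply: filterS (uA) => v /= h.
apply: l2ip_le => n.
change (pdot (l2val v - l) (l2val v - l) n <= e).
have -> : l2val v - l = (l2val v - l2val u) + (l2val u - l) by rewrite subrKA.
have h1 := pdot_parallelogram (l2val v - l2val u) (l2val u - l) n.
have h2 := pdot_ge0 (l2val v - l2val u - (l2val u - l)) n.
have h3 : pdot (l2val v - l2val u) (l2val v - l2val u) n <= e / 4.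
  exact: le_trans (pdot_le_l2ip (v - u) n) h.
have h4 : pdot (l2val u - l) (l2val u - l) n <= e / 4.
  apply: le_trans (close _ _ uA n); rewrite -[l2val u - l]opprB.
  rewrite -scaleN1r pdotJ scalerA.
  have -> : (-1)^* * -1 = 1 :> C by rewrite rmorphN1 mulrNN mulr1.
  by rewrite scale1r.
lra.
Qed.

Definition l2_hilbert : hilbert R :=
  Hilbert l2ipC l2ipDl l2ipZl l2ipJ l2ip_ge0 l2ip_eq0 l2_complete.

End SquareSummable.

(** * A Cuntz-Krieger family with nonzero vertex projections *)

Section CuntzKriegerModel.
Context {R : realType} (G : fin_digraph).
Local Notation V := (vert G).
Local Notation F := (V -> nat -> R[i]).
Local Notation L := (@l2 R V).
Local Notation H := (@l2_hilbert R V).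
Local Notation B := (BH H).

(** Here f spreads the first N coordinates over the first N d ones, so adjunction holds exactly
    between partial sums of these lengths. Taking f x or f' y as second argument turns the two
    compression bounds into contractivity of f and f'. *)
Lemma bounded_op (f f' : F -> F) (d : nat) : (0 < d)%N -> linear f ->
  (forall x y N, pdot (f x) y (N * d) = pdot x (f' y) N) ->
  (forall x N, pdot x (f' (f x)) N <= pdot x x N) ->
  (forall y N, pdot (f (f' y)) y N <= pdot y y N) ->
  {T : B | (forall x : L, l2val (T x) = f x) &
           forall y : L, l2val (cstar T y) = f' y}.
Proof.
move=> d0 fl adj ff' f'f.
have fb (x : F) N : pdot (f x) (f x) N <= pdot x x N.
  apply: le_trans (ff' x N); rewrite -adj.
  by apply: (pdot_nd (f x)); rewrite leq_pmulr.
have f'b (x : F) N : pdot (f' x) (f' x) N <= pdot x x (N * d).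
  by rewrite -adj; exact: f'f.
have fL (x : L) : f x \in @l2_pred R V.
  apply/asboolP; have [M xM] := l2_bound x; exists M => n.
  exact: le_trans (fb _ _) (xM _).
have f'L (x : L) : f' x \in @l2_pred R V.
  apply/asboolP; have [M xM] := l2_bound x; exists M => n.
  exact: le_trans (f'b _ _) (xM _).
pose T0 (x : L) : L := MkL2 (fL x).
pose T0' (x : L) : L := MkL2 (f'L x).
(* The partial sums of the left side converge along the subsequence of multiples of d. *)
have adj0 (x y : L) : l2ip (T0 x) y = l2ip x (T0' y).
  apply: cvg_unique (@l2ip_cvg R V x (T0' y)) => //.
  have := @l2ip_cvg R V (T0 x) y.
  move/(@cvg_comp _ _ _ (fun N => N * d)%N (fun n => pdot (T0 x) y n) \oo \oo).
  have mul_infty : (fun N : nat => (N * d)%N) @ \oo --> \oo.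
    by move=> A [N _ NA]; exists N => // n /= Nn; apply: NA => /=; rewrite (leq_trans Nn)// leq_pmulr.
  move=> /(_ mul_infty); apply: cvg_trans.
  by apply: near_eq_cvg; apply: nearW => N /=; rewrite adj.
have Tbop : (T0 : H -> H) \in @bop_pred R H.
  apply/asboolP; split.
  - by move=> a x y; apply/val_inj; exact: fl.
  - exists 1 => x; rewrite mul1r /hnorm ler_sqrt ?hip_ge0//.
    by apply: l2ip_le => n; apply: le_trans (fb _ _) (pdot_le_l2ip _ _).
  - by exists T0' => x y; exact: adj0.
exists (MkBH Tbop) => [x|y] //.
suff -> : cstar (MkBH Tbop : B) y = T0' y by []; apply: (@ip_inj R H) => z.
by rewrite -badjP; exact: adj0.
Qed.

(** Coordinate projections: in the model, P_v and all range projections S_e S_e^* have this form. *)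
Definition restrict (m : V -> nat -> bool) (x : F) : F :=
  fun v k => if m v k then x v k else 0.

Lemma pdot_restrict m x N : pdot (restrict m x) x N <= pdot x x N.
Proof.
apply: ler_sum => k _; apply: ler_sum => v _; rewrite /restrict; case: ifP => // _.
by rewrite {1}/cdot !mul0r addr0 cdot_ge0.
Qed.

Lemma restrict_linear m : linear (restrict m).
Proof.
move=> a x y; apply/funext => v; apply/funext => k.
change (restrict m (a *: x + y) v k = a * restrict m x v k + restrict m y v k).
by rewrite /restrict; case: ifP => // _; rewrite mulr0 addr0.
Qed.

Definition vproj (v : V) : F -> F := restrict (fun w _ => w == v).

Definition out_edges (v : V) := enum [pred e : edge G | src e == v].
Definition outdeg v := size (out_edges v).
Definition out_index (e : edge G) := index e (out_edges (src e)).

Lemma out_index_lt e : (out_index e < outdeg (src e))%N.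
Proof. by rewrite index_mem mem_enum inE. Qed.

Lemma out_index_inj e f : src e = src f -> out_index e = out_index f -> e = f.
Proof.
rewrite /out_index => ef_src; rewrite ef_src => ef.
have ein : e \in out_edges (src f) by rewrite mem_enum inE ef_src.
have fin : f \in out_edges (src f) by rewrite mem_enum inE.
by rewrite -(nth_index e ein) ef nth_index.
Qed.

(* The n edges leaving v split N into the residue classes mod n: the edge e maps
   the basis vector j at [rng e] to the basis vector j n + (index of e) at
   [src e].  As j |-> j n + i is increasing, the adjunction can be checked on
   partial sums. *)
Definition eshift (e : edge G) (x : F) : F := fun v k =>
  if (v == src e) && (k %% outdeg v == out_index e)%N
  then x (rng e) (k %/ outdeg v)%N else 0.

Definition eshift_adj (e : edge G) (y : F) : F := fun w j =>
  if w == rng e then y (src e) (j * outdeg (src e) + out_index e)%N else 0.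

Lemma eshift_linear e : linear (eshift e).
Proof.
move=> a x y; apply/funext => v; apply/funext => k.
change (eshift e (a *: x + y) v k = a * eshift e x v k + eshift e y v k).
by rewrite /eshift; case: ifP => // _; rewrite mulr0 addr0.
Qed.

Lemma cdot0l (a : R[i]) : cdot 0 a = 0.
Proof. by rewrite /cdot !mul0r addr0. Qed.

(** Each block of [outdeg (src e)] consecutive indices contains exactly one index in the residue
    class of e; it matches the next term on the right. *)
Lemma eshift_adjP e x y N :
  pdot (eshift e x) y (N * outdeg (src e)) = pdot x (eshift_adj e y) N.
Proof.
have ie := out_index_lt e.
elim: N => [|N IH]; first by rewrite mul0n /pdot !big_geq.
rewrite mulSn addnC {1}/pdot (@big_cat_nat _ _ _ (N * outdeg (src e)))//=; last exact: leq_addr.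
rewrite -/(pdot _ _ _) IH [RHS]/pdot big_nat_recr//=; congr (_ + _).
rewrite -{1}[(N * _)%N]add0n big_addn addKn.
rewrite big_mkord (bigD1 (Ordinal ie))//= [X in _ + X = _]big1 ?addr0 => [|j jN].
  rewrite [LHS](bigD1 (src e))//= [X in _ + X = _]big1 ?addr0 => [|v vN].
    rewrite [RHS](bigD1 (rng e))//= [X in _ = _ + X]big1 ?addr0 => [|v vN].
      rewrite /eshift /eshift_adj !eqxx /= addnC modnMDl modn_small// eqxx.
      by rewrite divnMDl ?(leq_ltn_trans _ ie)// divn_small// addn0.
    by rewrite /eshift_adj (negbTE vN) cdotC cdot0l.
  by rewrite /eshift (negbTE vN) cdot0l.
rewrite big1// => v _; rewrite /eshift; case: eqVneq => [->|_] /=; last by rewrite cdot0l.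
rewrite addnC modnMDl modn_small//.
case: eqP => [jE|_]; last by rewrite cdot0l.
by case/eqP: jN; apply: val_inj.
Qed.

(** Distinct edges have ranges with disjoint supports: they sit at different sources or in different
    residue classes. *)
Lemma eshift_adjK e f x :
  eshift_adj e (eshift f x) = if e == f then vproj (rng e) x else 0.
Proof.
have ie := out_index_lt e.
apply/funext => v; apply/funext => k; rewrite /eshift_adj /eshift.
rewrite modnMDl.
case: (eqVneq e f) => [<-|ef].
  rewrite eqxx modn_small//= eqxx /vproj /restrict; case: eqP => // ->.
  by rewrite divnMDl ?(leq_ltn_trans _ ie)// divn_small// addn0.
rewrite [(0 : F) v k]/(0 : R[i]); case: eqP => // _; case: eqP => //= se.
rewrite modn_small//; case: eqP => // /(out_index_inj se) fe.
by rewrite fe eqxx in ef.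
Qed.

Lemma eshiftK e y :
  eshift e (eshift_adj e y) =
  restrict (fun v k => (v == src e) && (k %% outdeg v == out_index e)%N) y.
Proof.
apply/funext => v; apply/funext => k; rewrite /eshift_adj /eshift /restrict eqxx.
by case: ifP => // /andP[/eqP -> /eqP <-]; rewrite -divn_eq.
Qed.

Lemma eshift_op e : {T : B | (forall x : L, l2val (T x) = eshift e x) &
  forall y : L, l2val (cstar T y) = eshift_adj e y}.
Proof.
apply: (@bounded_op _ _ (outdeg (src e))).
- exact: leq_ltn_trans (out_index_lt e).
- exact: eshift_linear.
- exact: eshift_adjP.
- by move=> x N; rewrite eshift_adjK eqxx pdotC; exact: pdot_restrict.
- by move=> y N; rewrite eshiftK; exact: pdot_restrict.
Qed.

Lemma vproj_op v : {T : B | (forall x : L, l2val (T x) = vproj v x) &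
  forall y : L, l2val (cstar T y) = vproj v y}.
Proof.
have vv x : vproj v (vproj v x) = vproj v x.
  by apply/funext => w; apply/funext => k; rewrite /vproj /restrict; case: eqP.
apply: (@bounded_op _ _ 1) => //.
- exact: restrict_linear.
- move=> x y N; rewrite muln1; apply: eq_bigr => k _; apply: eq_bigr => w _.
  by rewrite /vproj /restrict; case: eqP => // _; rewrite cdot0l cdotC cdot0l.
- by move=> x N; rewrite vv pdotC; exact: pdot_restrict.
- by move=> x N; rewrite vv; exact: pdot_restrict.
Qed.

Definition model_P v : B := s2val (vproj_op v).
Definition model_S e : B := s2val (eshift_op e).

Lemma model_PE v (x : L) : l2val (model_P v x) = vproj v x.
Proof. exact: (s2valP (vproj_op v)). Qed.
Lemma model_PaE v (x : L) : l2val (cstar (model_P v) x) = vproj v x.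
Proof. exact: (s2valP' (vproj_op v)). Qed.
Lemma model_SE e (x : L) : l2val (model_S e x) = eshift e x.
Proof. exact: (s2valP (eshift_op e)). Qed.
Lemma model_SaE e (x : L) : l2val (cstar (model_S e) x) = eshift_adj e x.
Proof. exact: (s2valP' (eshift_op e)). Qed.

Lemma model_ext (T U : B) : (forall x : L, l2val (T x) = l2val (U x)) -> T = U.
Proof. by move=> h; apply: BHP => x; apply/val_inj; exact: h. Qed.

Lemma modelM (T U : B) (x : L) : (T ** U) x = T (U x).
Proof. by []. Qed.

Lemma model_CK : CK_family model_P model_S.
Proof.
have v2 v w x : vproj v (vproj w x) = if v == w then vproj w x else 0.
  apply/funext => u; apply/funext => k; rewrite /vproj /restrict.
  case: (eqVneq v w) => [->|vw]; first by case: eqP.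
  rewrite [(0 : F) u k]/(0 : R[i]).
  by case: eqP => // ->; rewrite (negbTE vw).
split.
- move=> v; split; apply: model_ext => x.
    by rewrite modelM !model_PE v2 eqxx.
  by rewrite model_PaE model_PE.
- move=> v w vw; apply: model_ext => x.
  by rewrite modelM !model_PE v2 (negbTE vw).
- move=> e; apply: model_ext => x; rewrite modelM model_PE !model_SE.
  apply/funext => u; apply/funext => k; rewrite /vproj /restrict /eshift.
  by case: eqP.
- move=> e; apply: model_ext => x; rewrite modelM !model_SE model_PE.
  apply/funext => u; apply/funext => k; rewrite /vproj /restrict /eshift.
  by rewrite eqxx.
- move=> e f; apply: model_ext => x; rewrite modelM model_SaE model_SE eshift_adjK.
  by case: ifP => // _; rewrite model_PE.
- move=> v [e0 e0v]; apply: model_ext => x; rewrite model_PE.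
  have sumE (r : seq (edge G)) : l2val ((\sum_(e <- r | src e == v)
      model_S e ** cstar (model_S e)) x) =
      \sum_(e <- r | src e == v) restrict (fun w k =>
         (w == src e) && (k %% outdeg w == out_index e)%N) x.
    elim: r => [|e r IH]; first by rewrite !big_nil.
    rewrite !big_cons; case: ifP => // _.
    change (l2val ((model_S e ** cstar (model_S e)) x) + l2val ((\sum_(e <- r | src e == v)
      model_S e ** cstar (model_S e)) x) = restrict (fun w k =>
         (w == src e) && (k %% outdeg w == out_index e)%N) x + \sum_(e <- r | src e == v) restrict (fun w k =>
         (w == src e) && (k %% outdeg w == out_index e)%N) x).
    by rewrite IH modelM model_SE model_SaE eshiftK.
  rewrite sumE; apply/funext => w; apply/funext => k.
  rewrite !fct_sumE /=.
  rewrite /vproj /restrict; case: (eqVneq w v) => [->|wv]; last first.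
    by rewrite big1// => e /eqP ->; rewrite (negbTE wv).
  have d0 : (0 < outdeg v)%N by rewrite -e0v; exact: leq_ltn_trans (out_index_lt e0).
  have kd : (k %% outdeg v < outdeg v)%N by rewrite ltn_mod.
  (* The one edge leaving v whose residue class contains k; only its term of the sum is nonzero at
     (v, k). *)
  pose e1 := nth e0 (out_edges v) (k %% outdeg v)%N.
  have e1v : src e1 == v.
    by have := mem_nth e0 kd; rewrite mem_enum inE.
  have e1i : out_index e1 = (k %% outdeg v)%N.
    by rewrite /out_index (eqP e1v) index_uniq// enum_uniq.
  rewrite (bigD1 e1)//= (eqP e1v) eqxx e1i eqxx big1 ?addr0// => e /andP[/eqP ev ee1].
  rewrite ev eqxx /=; case: eqP => // ki; case/eqP: ee1.
  by apply: out_index_inj; rewrite ?(eqP e1v)// e1i.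
Qed.

Lemma model_P_neq0 v : model_P v != 0.
Proof.
apply/eqP => Pv0.
(* Supported at index 0 of every vertex, so that one vector witnesses all the projections. *)
pose d : F := fun w k => if (k == 0%N) then 1 else 0.
have dL : d \in @l2_pred R V.
  apply/asboolP; exists (\sum_(i : V) cdot 1 1) => -[|n].
    by rewrite /pdot big_geq// sumr_ge0// => *; exact: cdot_ge0.
  rewrite /pdot big_nat_recl//= [X in _ + X]big1 ?addr0// => k _.
  by rewrite big1// => w _; rewrite /d /= cdot0l.
have := model_PE v (MkL2 dL); rewrite Pv0 => /(congr1 (fun x => x v 0%N)).
rewrite [LHS]/(0 : R[i]) /vproj /restrict /d !eqxx => /eqP.
by rewrite eq_sym oner_eq0.
Qed.

End CuntzKriegerModel.

Lemma CK_proj_neq0 (R : realType) (G : fin_digraph) (A : cstarAlgType R)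
    (P : vert G -> A) (S : edge G -> A) : is_CK_algebra P S ->
  forall v, P v != 0.
Proof.
move=> [_ _ univ] v; apply/eqP => Pv0.
have [f [_ fP _]] := univ _ _ _ (model_CK (R := R) G).
have /eqP := @model_P_neq0 R G v; apply.
by rewrite -fP Pv0 linear0.
Qed.

(** * Elementary facts on C*-algebras *)

Section CStarBasics.
Context {R : realType} {A : cstarAlgType R}.
Implicit Types (x y z : A) (a : R[i]).

Lemma cmul0l x : 0 ** x = 0.
Proof. by have := cmulZl 0 x x; rewrite !scale0r. Qed.
Lemma cmul0r x : x ** 0 = 0.
Proof. by have := cmulZr 0 x x; rewrite !scale0r. Qed.
Lemma cmulNl x y : (- x) ** y = - (x ** y).
Proof. by rewrite -scaleN1r cmulZl scaleN1r. Qed.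
Lemma cmulNr x y : x ** (- y) = - (x ** y).
Proof. by rewrite -scaleN1r cmulZr scaleN1r. Qed.
Lemma cmulBl x y z : (x - y) ** z = x ** z - y ** z.
Proof. by rewrite cmulDl cmulNl. Qed.
Lemma cmulBr x y z : z ** (x - y) = z ** x - z ** y.
Proof. by rewrite cmulDr cmulNr. Qed.
Lemma cstar0 : (0 : A)^† = 0.
Proof. by have := cstarZ 0 (0 : A); rewrite conjC0 !scale0r. Qed.
Lemma cstarN x : (- x)^† = - x^†.
Proof. by rewrite -scaleN1r cstarZ rmorphN1 scaleN1r. Qed.
Lemma cstarB x y : (x - y)^† = x^† - y^†.
Proof. by rewrite cstarD cstarN. Qed.

Lemma cmul_suml (I : Type) (r : seq I) (Q : pred I) (F : I -> A) y :
  (\sum_(i <- r | Q i) F i) ** y = \sum_(i <- r | Q i) F i ** y.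
Proof. by apply: (big_morph (fun x => x ** y)) => [u v|]; rewrite ?cmulDl ?cmul0l. Qed.
Lemma cmul_sumr (I : Type) (r : seq I) (Q : pred I) (F : I -> A) y :
  y ** (\sum_(i <- r | Q i) F i) = \sum_(i <- r | Q i) y ** F i.
Proof. by apply: (big_morph (fun x => y ** x)) => [u v|]; rewrite ?cmulDr ?cmul0r. Qed.
Lemma cstar_sum (I : Type) (r : seq I) (Q : pred I) (F : I -> A) :
  (\sum_(i <- r | Q i) F i)^† = \sum_(i <- r | Q i) (F i)^†.
Proof. by apply: (big_morph (fun x => x^†)) => [u v|]; rewrite ?cstarD ?cstar0. Qed.

Lemma norm_cstar x : `|x^†| = `|x|.
Proof.
have le y : `|y| <= `|y^†|.
  have [->|y0] := eqVneq y 0; first by rewrite cstar0.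
  have yp : 0 < `|y| by rewrite normr_gt0.
  rewrite -(ler_pM2r yp) -expr2 -normr_cstar_cmul; exact: normr_cmul.
by apply/le_anti; rewrite le andbT -{2}[x]cstarK le.
Qed.

Lemma proj_norm_le1 x : projection x -> `|x| <= 1.
Proof.
move=> [xx xs]; have : `|x| ^+ 2 = `|x| by rewrite -normr_cstar_cmul xs xx.
have [->|x0] := eqVneq x 0; first by rewrite normr0 ler01.
have n0 : `|x| != 0 by rewrite normr_eq0.
by rewrite expr2 -[RHS]mulr1 => /(mulfI n0) ->.
Qed.

Lemma proj_norm1 x : projection x -> x != 0 -> `|x| = 1.
Proof.
move=> [xx xs]; have : `|x| ^+ 2 = `|x| by rewrite -normr_cstar_cmul xs xx.
rewrite -normr_eq0 => h n0.
by move: h; rewrite expr2 -[RHS]mulr1 => /(mulfI n0) ->.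
Qed.

Lemma norm_cmul_le1 x y a : `|x| <= 1 -> `|y| <= a -> `|x ** y| <= a.
Proof.
move=> x1 ya; apply: le_trans (normr_cmul _ _) _; rewrite -[a]mul1r.
by apply: ler_pM.
Qed.

Lemma norm_le_eps x (K : R[i]) : 0 <= K ->
  (forall e : R[i], 0 < e -> `|x| <= K * e) -> x = 0.
Proof.
move=> K0 h; apply/eqP; rewrite -normr_eq0; apply: contraT => x0.
have xp : 0 < `|x| by rewrite lt_def x0 normr_ge0.
have K1 : 0 < K + 1 by rewrite ltr_wpDl.
have := h (`|x| / (K + 1)); rewrite divr_gt0// => /(_ isT).
rewrite mulrA ler_pdivlMr// mulrC ler_pM2r// => h2.
have : K < K + 1 by rewrite ltrDl.
by move=> /lt_le_trans /(_ h2); rewrite ltxx.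
Qed.

Lemma closed_approx (M : set A) x : closed M ->
  (forall e : R[i], 0 < e -> exists2 y, M y & `|x - y| < e) -> M x.
Proof.
move=> Mc h; apply: Mc => B /nbhs_ballP [e /= e0 eB].
have [y My xy] := h e e0; exists y; split => //; apply: eB.
by rewrite -ball_normE.
Qed.

Lemma closedP (M : set A) :
  (forall x, (forall e : R[i], 0 < e -> exists2 y, M y & `|x - y| < e) -> M x) ->
  closed M.
Proof.
move=> h x xM; apply: h => e e0.
have [y [My]] := xM _ (nbhsx_ballx x e e0); rewrite -ball_normE => xy.
by exists y.
Qed.

(** The norm closure of [M], in the form that estimates produce and consume. *)
Definition approx (M : set A) : set A :=
  [set x | forall e : R[i], 0 < e -> exists2 y, M y & `|x - y| < e].

Lemma half_gt0 (e : R[i]) : 0 < e -> 0 < e / 2.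
Proof. by move=> e0; rewrite divr_gt0. Qed.

Lemma approx_closed (M : set A) : closed (approx M).
Proof.
apply: closedP => x h e /half_gt0 e0.
have [y yM xy] := h _ e0; have [z zM yz] := yM _ e0.
exists z => //; rewrite [e](splitr e) -(subrKA y).
exact: le_lt_trans (ler_normD _ _) (ltrD xy yz).
Qed.

Lemma sub_approx (M : set A) : M `<=` approx M.
Proof. by move=> x Mx e e0; exists x => //; rewrite subrr normr0. Qed.

Lemma approx_linear (M N : set A) (f : A -> A) (K : R[i]) : 0 <= K ->
  (forall x y, `|f x - f y| <= K * `|x - y|) ->
  (forall x, M x -> approx N (f x)) -> forall x, approx M x -> approx N (f x).
Proof.
move=> K0 fK MN x xM; apply: (closed_approx (@approx_closed N)) => e e0.
have K1 : 0 < K + 1 by rewrite ltr_wpDl.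
have [y My xy] := xM _ (divr_gt0 e0 K1).
exists (f y); first exact: MN.
apply: le_lt_trans (fK _ _) _.
apply: (@le_lt_trans _ _ (K * (e / (K + 1)))); first by rewrite ler_wpM2l// ltW.
by rewrite mulrCA gtr_pMr// ltr_pdivrMr// mul1r ltrDl.
Qed.

Lemma approx_add (M : set A) : (forall x y, M x -> M y -> M (x + y)) ->
  forall x y, approx M x -> approx M y -> approx M (x + y).
Proof.
move=> MD x y Mx My e /half_gt0 e0.
have [x' Mx' xx'] := Mx _ e0; have [y' My' yy'] := My _ e0.
exists (x' + y'); first exact: MD.
rewrite [e](splitr e) opprD addrACA.
exact: le_lt_trans (ler_normD _ _) (ltrD xx' yy').
Qed.

(** As |D| > 0, the approximating coefficients form a Cauchy sequence; their real and imaginary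
    parts converge in R. *)
Lemma line_closed (D x : A) : D != 0 ->
  (forall e : R[i], 0 < e -> exists a : R[i], `|x - a *: D| < e) ->
  exists a : R[i], x = a *: D.
Proof.
move=> D0 h.
have Dp : 0 < `|D| by rewrite normr_gt0.
(* The factor |D| cancels when distances on the line are turned into distances between
   coefficients. *)
have posn (n : nat) : 0 < n.+1%:R^-1 * `|D| :> R[i] by rewrite mulr_gt0// invr_gt0.
have /choice[u uP] : forall n : nat, exists a : R[i], `|x - a *: D| < n.+1%:R^-1 * `|D|.
  by move=> n; exact: h.
have uc n m : `|u n - u m| <= n.+1%:R^-1 + m.+1%:R^-1.
  rewrite -(ler_pM2r Dp) -normrZ scalerBl mulrDl.
  have -> : u n *: D - u m *: D = - (x - u n *: D) + (x - u m *: D).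
    by rewrite opprB subrKA.
  apply: le_trans (ler_normD _ _) _; rewrite normrN.
  by rewrite lerD// ltW.
have lim_ex (f : R[i] -> R) : (forall a b, f (a - b) = f a - f b) ->
    (forall a, (`|f a|)%:C%C <= `|a|) ->
    exists l : R, (f \o u) @ \oo --> l.
  move=> fB fle; apply/cvg_ex; apply: R_complete; apply: cauchy_exP => e e0.
  have e20 : 0 < e / 2 by rewrite divr_gt0.
  have : \forall n \near \oo, n.+1%:R^-1 < e / 2 :> R.
    exact: (near_infty_natSinv_lt (PosNum e20)).
  case=> N _ NP; exists (f (u N)); exists N => // n /= Nn.
  rewrite /ball /= -fB -ltcR; apply: le_lt_trans (fle _) _.
  apply: le_lt_trans (uc _ _) _.
  rewrite [e]splitr rmorphD; apply: ltrD.
    by have := NP N (leqnn _); rewrite -ltcR fmorphV rmorph_nat.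
  by have := NP n Nn; rewrite -ltcR fmorphV rmorph_nat.
have [lr lrP] : exists l : R, (@complex.Re R \o u) @ \oo --> l.
  apply: lim_ex => [[a b] [c d]//|[a b]].
  by rewrite normc_def lecR /= -sqrtr_sqr ler_wsqrtr// lerDl sqr_ge0.
have [li liP] : exists l : R, (@complex.Im R \o u) @ \oo --> l.
  apply: lim_ex => [[a b] [c d]//|[a b]].
  by rewrite normc_def lecR /= -sqrtr_sqr ler_wsqrtr// lerDr sqr_ge0.
exists (lr +i* li)%C; apply/eqP; rewrite -subr_eq0; apply/eqP.
apply: (@norm_le_eps _ (3 * `|D|)) => [|e' e'0]; first by rewrite mulr_ge0.
have [e e0 ->] : exists2 e : R, 0 < e & e' = e%:C%C.
  have /complex_realP[r er] := gtr0_real e'0.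
  by exists r; rewrite -?ltcR -?er.
have : \forall n \near \oo, n.+1%:R^-1 < e :> R.
  exact: (near_infty_natSinv_lt (PosNum e0)).
move=> n1; have /cvgrPdist_lt/(_ _ e0) n2 := lrP.
have /cvgrPdist_lt/(_ _ e0) n3 := liP.
have [n [[/= h1 h2] h3]] := filter_ex (filterI (filterI n1 n2) n3).
have -> : x - (lr +i* li)%C *: D = (x - u n *: D) + (u n - (lr +i* li)%C) *: D.
  by rewrite scalerBl subrKA.
apply: le_trans (ler_normD _ _) _.
(* One share of e for x - u_n D, and one each for the real and the imaginary part of the
   coefficient. *)
have -> : 3 * `|D| * e%:C%C = e%:C%C * `|D| + (e%:C%C + e%:C%C) * `|D| by ring.
apply: lerD.
  apply: ltW; apply: lt_le_trans (uP n) _; rewrite ler_pM2r//.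
  by move: h1; rewrite -ltcR fmorphV rmorph_nat => /ltW.
rewrite normrZ ler_pM2r// distrC.
case: (u n) h2 h3 => a b /= h2 h3.
have -> : (lr +i* li)%C - (a +i* b)%C = (lr - a)%:C%C + 'i%C * (li - b)%:C%C.
  by simpc.
apply: le_trans (ler_normD _ _) _; rewrite normrM.
have nR (t : R) : `|t%:C%C| = `|t|%:C%C.
  by rewrite normc_def /= expr0n addr0 sqrtr_sqr.
have -> : `|'i%C| = 1 :> R[i] by rewrite normc_def /= expr0n expr1n add0r sqrtr1.
by rewrite mul1r !nR lerD// lecR ltW.
Qed.

End CStarBasics.

(** * Powers and polynomials in a corner *)

Section Corner.
Context {R : realType} {A : cstarAlgType R} (v : A).
Hypothesis hv : projection v.
Implicit Types (x y z c : A) (p q : {poly R[i]}).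

(** The corner v A v, with unit v; accordingly v is the zeroth power in [cexp] and the value of the
    constant 1 in [ev]. *)
Definition corner : set A := [set x | v ** x = x /\ x ** v = x].

(* Locked, lest rewriting with [cmulA] unfold powers. *)
Definition cexp x n : A := locked (iter n (cmul x) v).

Lemma cexp0 x : cexp x 0 = v. Proof. by rewrite /cexp -lock. Qed.
Lemma cexpS x n : cexp x n.+1 = x ** cexp x n.
Proof. by rewrite /cexp -!lock. Qed.

Lemma corner_v : corner v. Proof. by have [vv _] := hv. Qed.

Lemma cornerM x y : corner x -> corner y -> corner (x ** y).
Proof. by move=> [vx xv] [vy yv]; split; rewrite ?cmulA ?vx// -cmulA yv. Qed.

Lemma corner_star x : corner x -> corner x^†.
Proof.
have [_ vs] := hv.
by move=> [vx xv]; split; rewrite -{1}vs -cstarM ?vx ?xv.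
Qed.

Lemma cornerD x y : corner x -> corner y -> corner (x + y).
Proof. by move=> [vx xv] [vy yv]; split; rewrite ?(cmulDr, cmulDl) ?vx ?vy ?xv ?yv. Qed.

Lemma cornerZ a x : corner x -> corner (a *: x).
Proof. by move=> [vx xv]; split; rewrite ?cmulZl ?cmulZr ?vx ?xv. Qed.

Lemma corner0 : corner 0. Proof. by split; rewrite ?cmul0l ?cmul0r. Qed.

Lemma corner_exp x n : corner x -> corner (cexp x n).
Proof. by move=> cx; elim: n => [|n IH]; rewrite (cexp0, cexpS); [exact: corner_v | exact: cornerM]. Qed.

Lemma cexpD x m n : corner x -> cexp x (m + n) = cexp x m ** cexp x n.
Proof.
move=> cx; elim: m => [|m IH]; first by rewrite cexp0; have [-> _] := corner_exp n cx.
by rewrite addSn !cexpS IH cmulA.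
Qed.

Lemma cexp1 x : corner x -> cexp x 1 = x.
Proof. by rewrite cexpS cexp0; case. Qed.

Lemma com_exp x y n : corner x -> x ** y = y ** x -> x ** cexp y n = cexp y n ** x.
Proof.
move=> [vx xv] xy; elim: n => [|n IH]; first by rewrite cexp0 vx xv.
by rewrite cexpS cmulA xy -cmulA IH cmulA.
Qed.

Lemma cexpSr x n : corner x -> cexp x n.+1 = cexp x n ** x.
Proof. by move=> cx; rewrite cexpS com_exp. Qed.

Lemma cexp_star x n : corner x -> (cexp x n)^† = cexp x^† n.
Proof.
move=> cx; elim: n => [|n IH]; first by rewrite !cexp0; have [_] := hv.
by rewrite cexpSr// cstarM IH cexpS.
Qed.

Lemma norm_cexp x n (a : R[i]) : 0 <= a -> `|x| <= a -> `|cexp x n| <= a ^+ n.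
Proof.
move=> a0 xa; elim: n => [|n IH]; first by rewrite cexp0; exact: proj_norm_le1.
by rewrite cexpS exprS; apply: le_trans (normr_cmul _ _) _; rewrite ler_pM.
Qed.

Definition ev c (p : {poly R[i]}) : A := \sum_(i < size p) p`_i *: cexp c i.

Lemma ev_wide c p n : (size p <= n)%N -> ev c p = \sum_(i < n) p`_i *: cexp c i.
Proof.
move=> pn; rewrite /ev (big_ord_widen n (fun i => p`_i *: cexp c i) pn).
rewrite big_mkcond; apply: eq_bigr => i _; case: ltnP => // ip.
by rewrite nth_default// scale0r.
Qed.

Lemma evD c p q : ev c (p + q) = ev c p + ev c q.
Proof.
pose n := maxn (size p) (size q).
rewrite (@ev_wide c (p + q) n) ?size_polyD// (@ev_wide c p n) ?leq_maxl//.
rewrite (@ev_wide c q n) ?leq_maxr// -big_split.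
by apply: eq_bigr => i _; rewrite coefD scalerDl.
Qed.

Lemma evZ c a p : ev c (a *: p) = a *: ev c p.
Proof.
rewrite (@ev_wide c (a *: p) (size p)) ?size_scale_leq// scaler_sumr.
by apply: eq_bigr => i _; rewrite coefZ scalerA.
Qed.

Lemma ev0 c : ev c 0 = 0.
Proof. by rewrite /ev size_poly0 big_ord0. Qed.

Lemma ev1 c : ev c 1 = v.
Proof. by rewrite /ev size_poly1 big_ord1 coef1 scale1r cexp0. Qed.

Lemma evXn c n : ev c 'X^n = cexp c n.
Proof.
rewrite /ev size_polyXn (bigD1 ord_max)//= coefXn eqxx scale1r big1 ?addr0//.
move=> i ni; rewrite coefXn; case: eqP => [i_n|]; last by rewrite scale0r.
by case/eqP: ni; apply: val_inj.
Qed.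

Lemma ev_mulX c p : ev c (p * 'X) = c ** ev c p.
Proof.
have [->|p0] := eqVneq p 0; first by rewrite mul0r ev0 cmul0r.
rewrite /ev size_mulX// big_ord_recl coefMX eqxx scale0r add0r cmul_sumr.
by apply: eq_bigr => i _; rewrite coefMX /= cmulZr cexpS.
Qed.

Lemma corner_ev c p : corner c -> corner (ev c p).
Proof.
move=> cc; rewrite /ev; apply: (big_ind corner); first exact: corner0.
  exact: cornerD.
by move=> i _; apply/cornerZ/corner_exp.
Qed.

Lemma evM c p q : corner c -> ev c (p * q) = ev c p ** ev c q.
Proof.
move=> cc; elim/poly_ind: p => [|p a IH]; first by rewrite mul0r ev0 cmul0l.
rewrite mulrDl mulrAC evD ev_mulX IH evD ev_mulX mul_polyC evZ.
rewrite -[a%:P]mulr1 mul_polyC evZ ev1 cmulDl cmulA cmulZl.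
by have [-> _] := corner_ev q cc.
Qed.

Lemma ev_exp c p n : corner c -> ev c (p ^+ n) = cexp (ev c p) n.
Proof.
move=> cc; elim: n => [|n IH]; first by rewrite expr0 ev1 cexp0.
by rewrite exprS evM// IH cexpS.
Qed.

Lemma com_ev c x p : corner x -> x ** c = c ** x -> x ** ev c p = ev c p ** x.
Proof.
move=> cx xc; rewrite /ev cmul_sumr cmul_suml; apply: eq_bigr => i _.
by rewrite cmulZl cmulZr com_exp.
Qed.

(** * Isometries of a corner and their defect projection *)

Section Isometry.
Variable c : A.
Hypothesis cc : corner c.
Hypothesis c_iso : c^† ** c = v.

Let D := v - c ** c^†.

Lemma isometry_norm : `|c| <= 1.
Proof.
have : `|c| ^+ 2 <= 1 by rewrite -normr_cstar_cmul c_iso; exact: proj_norm_le1.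
by rewrite expr_le1.
Qed.

Lemma defect_corner : corner D.
Proof.
rewrite /D -scaleN1r; apply: cornerD; first exact: corner_v.
by apply/cornerZ/cornerM => //; exact: corner_star.
Qed.

Lemma star_defect : c^† ** D = 0.
Proof.
have [_ cv] := corner_star cc.
by rewrite /D cmulBr cv cmulA c_iso; have [-> _] := corner_star cc; rewrite subrr.
Qed.

Lemma defect_proj : projection D.
Proof.
have [vv vs] := hv; split.
  by rewrite {1}/D cmulBl -cmulA star_defect cmul0r subr0; have [->] := defect_corner.
by rewrite /D cstarB cstarM cstarK vs.
Qed.

Lemma cexp_iso n : cexp c^† n ** cexp c n = v.
Proof.
elim: n => [|n IH]; first by rewrite !cexp0; have [] := hv.
rewrite cexpSr; last exact: corner_star.
by rewrite cexpS -cmulA (cmulA c^†) c_iso; have [-> _] := corner_exp n cc.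
Qed.

(** Since c^* D = 0, the ranges of the c^i D are mutually orthogonal, as in the Wold
    decomposition. *)
Lemma cexp_defect i j : D ** cexp c^† i ** cexp c j ** D = if i == j then D else 0.
Proof.
have [DD Ds] := defect_proj; have [vD Dv] := defect_corner.
have cD n : cexp c^† n.+1 ** D = 0.
  by rewrite cexpSr ?cmulA; [rewrite -cmulA star_defect cmul0r | exact: corner_star].
have Dc n : D ** cexp c n.+1 = 0.
  rewrite -[LHS]cstarK cstarM Ds cexp_star// cD cstar0//.
case: ltngtP => [ij|ji|->].
- rewrite -(subnKC ij) addSnnS cexpD// -!cmulA (cmulA (cexp c^† i)) cexp_iso.
  by rewrite (cmulA D) Dv (cmulA D) Dc cmul0l.
- rewrite -(subnKC ji) addSnnS addnC cexpD; last exact: corner_star.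
  rewrite -!cmulA (cmulA (cexp c^† j)) cexp_iso vD cD cmul0r//.
- by rewrite -cmulA -cmulA (cmulA (cexp c^† j)) cexp_iso vD.
Qed.

(** Only contractions multiply p(c) D here, so for nonzero D every coefficient satisfies |p_i| <=
    |p(c) D|. *)
Lemma ev_defect p i : D ** cexp c^† i ** ev c p ** D = p`_i *: D.
Proof.
rewrite /ev cmul_sumr cmul_suml.
have [ip|pi] := ltnP i (size p).
  rewrite (bigD1 (Ordinal ip))//= cmulZr cmulZl cexp_defect eqxx big1 ?addr0//.
  by move=> j ji; rewrite cmulZr cmulZl cexp_defect eq_sym ifN ?scaler0.
rewrite nth_default// scale0r big1// => j _.
by rewrite cmulZr cmulZl cexp_defect ifN ?scaler0// gtn_eqF// (leq_trans _ pi).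
Qed.

End Isometry.
End Corner.

(** * Commutants of isometries *)

Section Toeplitz.
Context {R : realType} {A : cstarAlgType R} (v : A).
Hypothesis hv : projection v.
Variable c : A.
Hypothesis cc : corner v c.
Hypothesis c_iso : c^† ** c = v.
Local Notation D := (v - c ** c^†).
Hypothesis D_neq0 : D != 0.

(** The C*-identity squares the norm of a self-adjoint power. It reaches exponents 2^m only, which
    dictates the exponent chosen in [laurent_self_adjoint_eq0]. *)
Lemma norm_exp_self_adjoint (y : A) m : corner v y -> y^† = y ->
  `|cexp v y (2 ^ m)| = `|y| ^+ (2 ^ m).
Proof.
move=> cy ys; elim: m => [|m IH]; first by rewrite expn0 (cexp1 cy) expr1.
rewrite expnS mul2n -addnn cexpD// exprD -IH -expr2 -normr_cstar_cmul.
by rewrite (cexp_star hv)// ys.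
Qed.

(** s n + 1 < (n + 1)^2 <= (2^n)^2. *)
Lemma exp_beats_linear s n : (s <= n)%N -> (0 < n)%N -> (s * n + 1 < 4 ^ n)%N.
Proof.
move=> sn n0.
have h : (n.+1 * n.+1 <= 4 ^ n)%N.
  by rewrite -[4%N]/(2 * 2)%N expnMn leq_mul// ltn_expl.
apply: leq_trans h; nia.
Qed.

(* Let Y = y c^N be e-close to a polynomial h = p(c), with e = |y| / 8.  As Y D = 0
   and Y commutes with h, h^i D = (h - Y)^i D, so all coefficients of p^i are at
   most e^i in norm and |y h^i| grows at most like i e^i.  Expanding
   Y = h + (Y - h) gives |y|^(n+1) = |y^(n+1)| <= |y Y^n| = O(n (2 e)^n) for
   n + 1 a power of 2, which is absurd for large n. *)
Lemma laurent_self_adjoint_eq0 (y : A) : corner v y -> y^† = y ->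
  y ** c = c ** y -> y ** D = 0 ->
  (forall e : R[i], 0 < e ->
     exists N, exists p, `|y ** cexp v c N - ev v c p| < e) ->
  y = 0.
Proof.
move=> cy ys yc yD yapp; apply/eqP; rewrite -normr_eq0; apply: contraT => y0.
have dp : 0 < `|y| by rewrite lt_def y0 normr_ge0.
set d := `|y| in dp.
have e0 : 0 < d / 8 by rewrite divr_gt0.
set e := d / 8 in e0.
have [N [p]] := yapp _ e0.
set C := cexp v c N; set Y := y ** C; set h := ev v c p => Yh.
have cC : corner v C by exact: corner_exp.
have yC : y ** C = C ** y by exact: com_exp.
have cY : corner v Y by exact: cornerM.
have Yc : Y ** c = c ** Y.
  have Cc : C ** c = c ** C by rewrite /C -cexpSr ?cexpS.
  by rewrite /Y -cmulA Cc cmulA yc -cmulA.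
have ch : corner v h by exact: corner_ev.
have hY : h ** Y = Y ** h by rewrite /h (com_ev _ cY).
pose E := Y - h.
have cE : corner v E by apply: cornerD => //; rewrite -scaleN1r; exact: cornerZ.
have En : `|E| <= e by exact: ltW.
have hE : E ** h = h ** E by rewrite /E cmulBl cmulBr hY.
have YD : Y ** D = 0 by rewrite /Y yC -cmulA yD cmul0r.
have Dn := proj_norm1 (defect_proj hv cc c_iso) D_neq0.
have cn : `|c^†| <= 1 by rewrite norm_cstar; exact: (isometry_norm hv c_iso).
have hiD i : `|cexp v h i ** D| <= e ^+ i.
  elim: i => [|i IH].
    rewrite cexp0; have [-> _] := defect_corner hv cc.
    by rewrite Dn expr0.
  have -> : cexp v h i.+1 ** D = - (E ** (cexp v h i ** D)).
    have Yi : Y ** (cexp v h i ** D) = 0.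
      by rewrite cmulA com_exp// -cmulA YD cmul0r.
    by rewrite /E cmulBl Yi sub0r opprK cmulA cexpS.
  rewrite normrN exprS; apply: le_trans (normr_cmul _ _) _.
  by rewrite ler_pM.
have coef i j : `|(p ^+ i)`_j| <= e ^+ i.
  rewrite -[leLHS]mulr1 -Dn -normrZ -(ev_defect hv cc c_iso) ev_exp// -!cmulA.
  apply: norm_cmul_le1; first by rewrite Dn.
  apply: norm_cmul_le1 (hiD i).
  by have := norm_cexp hv j ler01 cn; rewrite expr1n.
have cjn j : `|cexp v c j| <= 1.
  by have := norm_cexp hv j ler01 (isometry_norm hv c_iso); rewrite expr1n.
(* p^i has at most (size p) m + 1 coefficients, each at most e^i in norm; bounding i by m makes the
   factor uniform. *)
have yh m i : (i <= m)%N -> `|y ** cexp v h i| <= d * (size p * m + 1)%:R * e ^+ i.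
  move=> im; rewrite -ev_exp// /ev cmul_sumr.
  apply: le_trans (ler_norm_sum _ _ _) _.
  apply: (@le_trans _ _ (\sum_(j < size (p ^+ i)) (d * e ^+ i))).
    apply: ler_sum => j _; rewrite cmulZr normrZ mulrC.
    apply: ler_pM => //.
    by apply: le_trans (normr_cmul _ _) _; rewrite -[leRHS]mulr1 ler_pM.
  rewrite sumr_const card_ord -[leLHS]mulr_natr [leRHS]mulrAC.
  rewrite ler_wpM2l ?mulr_ge0 ?exprn_ge0 ?normr_ge0 ?(ltW e0)// ler_nat.
  apply: leq_trans (size_poly_exp_leq _ _) _; rewrite addn1 ltnS.
  by rewrite leq_mul ?leq_pred.
(* Each factor Y is split as h + E, with i and j counting the factors h and E already extracted; n
   splittings give 2^n terms. *)
have key m n : forall i j, (i + j + n <= m)%N ->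
    `|y ** cexp v h i ** cexp v E j ** cexp v Y n| <=
    d * (size p * m + 1)%:R * e ^+ (i + j) * (2 * e) ^+ n.
  elim: n => [|n IH] i j ijn.
    rewrite cexp0 expr0 mulr1.
    have [_ ->] : corner v (y ** cexp v h i ** cexp v E j).
      by do 2?[apply: cornerM] => //; exact: corner_exp.
    rewrite exprD mulrA; apply: le_trans (normr_cmul _ _) _.
    apply: ler_pM => //; first by apply: yh; lia.
    by apply: norm_cexp => //; exact: ltW.
  have -> : y ** cexp v h i ** cexp v E j ** cexp v Y n.+1 =
     y ** cexp v h i.+1 ** cexp v E j ** cexp v Y n +
     y ** cexp v h i ** cexp v E j.+1 ** cexp v Y n.
    have YhE : Y = h + E by rewrite /E addrC subrK.
    rewrite -cmulDl cexpS {1}YhE cmulA; congr (_ ** _).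
    rewrite cmulDr; congr (_ + _); last by rewrite -!cmulA cexpSr.
    rewrite cexpSr// -!cmulA; congr (_ ** (_ ** _)).
    by rewrite com_exp.
  apply: le_trans (ler_normD _ _) _.
  have h1 := IH i.+1 j; have h2 := IH i j.+1.
  apply: le_trans (lerD (h1 _) (h2 _)) _; [lia|lia|].
  rewrite (addSn i) (addnS i) le_eqVlt; apply/orP; left; apply/eqP.
  by rewrite [e ^+ _.+1]exprS [in RHS]exprS; ring.
(* C commutes with y, so every C can be moved to the far left and cancelled by C^*, of norm at most
   1. *)
have low n : forall k, `|cexp v y (k + n)| <= `|cexp v y k ** cexp v Y n|.
  elim: n => [|n IH] k.
    by rewrite addn0 cexp0; have [_ ->] := corner_exp hv k cy.
  rewrite addnS -addSn; apply: le_trans (IH _) _.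
  have -> : cexp v y k ** cexp v Y n.+1 = C ** (cexp v y k.+1 ** cexp v Y n).
    have E1 : cexp v y k ** Y = C ** cexp v y k.+1.
      by rewrite (com_exp k.+1 cC (esym yC)) (cexpSr k cy) -cmulA.
    by rewrite [cexp v Y _]cexpS cmulA E1 cmulA.
  set w := _ ** cexp v Y n.
  have {1}-> : w = C^† ** (C ** w).
    have [vw _] : corner v w by apply: cornerM; exact: corner_exp.
    by rewrite cmulA /C cexp_star// cexp_iso.
  by apply: norm_cmul_le1 => //; rewrite norm_cstar; exact: cjn.
(* n + 1 is a power of 2 for [norm_exp_self_adjoint], and n >= s > [size p]; the successor keeps n
   positive even when p = 0. *)
pose s := (size p).+1; pose n := (2 ^ s).-1.
have n1 : n.+1 = (2 ^ s)%N by rewrite prednK// expn_gt0.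
have sn : (s <= n)%N by rewrite -ltnS n1 ltn_expl.
have : d ^+ n.+1 <= d * (size p * n + 1)%:R * (2 * e) ^+ n.
  rewrite n1 -norm_exp_self_adjoint// -n1 -(add1n n); apply: le_trans (low _ _) _.
  have := key n n 0%N 0%N; rewrite !add0n !cexp0 expr0 mulr1 (cexp1 cy) => /(_ (leqnn _)).
  by have [_ ->] := cy; have [_ ->] := cy.
(* The choice e = d / 8 reduces the estimate to 4^n <= (size p) n + 1. *)
have -> : 2 * e = d / 4 by rewrite /e; field.
rewrite exprS -mulrA ler_pM2l// expr_div_n mulrCA -[leLHS]mulr1.
rewrite ler_pM2l ?exprn_gt0// => hn.
have := exp_beats_linear (leq_trans (leqnSn _) sn) (leq_trans (ltn0Sn _) sn).
rewrite ltnNge => /negP; case.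
rewrite -(ler_nat R[i]) natrX.
by move: hn; rewrite ler_pdivlMr ?exprn_gt0// mul1r.
Qed.

End Toeplitz.

Section ToeplitzScalar.
Context {R : realType} {A : cstarAlgType R} (v : A).
Hypothesis hv : projection v.
Variable c : A.
Hypothesis cc : corner v c.
Hypothesis c_iso : c^† ** c = v.
Local Notation D := (v - c ** c^†).
Hypothesis D_neq0 : D != 0.

Definition laurent : set A := [set y | forall e : R[i], 0 < e ->
  exists N, exists p, `|y ** cexp v c N - ev v c p| < e].

Lemma laurentD x y : laurent x -> laurent y -> laurent (x + y).
Proof.
move=> xl yl e /half_gt0 e0; have [N [p xp]] := xl _ e0; have [M [q yq]] := yl _ e0.
(* Both approximations are shifted to the exponent N + M; as |c| <= 1 this does not enlarge the
   errors. *)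
exists (N + M)%N, (p * 'X^M + q * 'X^N); rewrite evD !evM// !evXn.
rewrite cmulDl opprD addrACA [e]splitr.
have cn k : `|cexp v c k| <= 1.
  by have := norm_cexp hv k ler01 (isometry_norm hv c_iso); rewrite expr1n.
have shift u r k l : `|u ** cexp v c k - ev v c r| < e / 2 ->
    `|u ** cexp v c (k + l) - ev v c r ** cexp v c l| < e / 2.
  rewrite cexpD// cmulA -cmulBl; apply: le_lt_trans.
  apply: le_trans (normr_cmul _ _) _.
  by rewrite -[leRHS]mulr1 ler_pM.
apply: le_lt_trans (ler_normD _ _) (ltrD _ _); first exact: shift.
by rewrite addnC; exact: shift.
Qed.

Lemma laurentZ a y : laurent y -> laurent (a *: y).
Proof.
move=> yl e e0; have a1 : 0 < `|a| + 1 by rewrite ltr_wpDl.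
have [N [p yp]] := yl _ (divr_gt0 e0 a1); exists N, (a *: p).
rewrite evZ cmulZl -scalerBr normrZ.
apply: (@le_lt_trans _ _ (`|a| * (e / (`|a| + 1)))).
  by rewrite ler_wpM2l// ltW.
by rewrite mulrCA gtr_pMr// ltr_pdivrMr// mul1r ltrDl.
Qed.

Lemma laurent_v : laurent v.
Proof.
move=> e e0; exists 0%N, 1; rewrite cexp0 ev1.
by have [-> _] := hv; rewrite subrr normr0.
Qed.

(* Compressing by the defect projection D = v - c c^* kills all Laurent monomials
   but the constant one, so y D = a D; the self-adjoint parts of y - a v then
   annihilate D. *)
Lemma laurent_commutant_scalar (y : A) : corner v y -> y ** c = c ** y ->
  y ** c^† = c^† ** y -> laurent y -> laurent y^† -> exists a, y = a *: v.
Proof.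
move=> cy yc ycs yl ysl.
have cD := defect_corner hv cc; have [DD Ds] := defect_proj hv cc c_iso.
have cs := corner_star hv cc.
have Dn := proj_norm1 (defect_proj hv cc c_iso) D_neq0.
have yD : y ** D = D ** y.
  rewrite cmulBl cmulBr; have [-> ->] := cy; congr (_ - _).
  by rewrite cmulA yc -cmulA ycs cmulA.
have [a yDa] : exists a, y ** D = a *: D.
  apply: line_closed => // e e0; have [N [p yp]] := yl _ e0; exists p`_N.
  rewrite -(ev_defect hv cc c_iso).
  have -> : y ** D = D ** cexp v c^† N ** (y ** cexp v c N) ** D.
    rewrite -(cmulA D) (cmulA (cexp v c^† N)) -(com_exp N cy ycs) -(cmulA y).
    by rewrite cexp_iso//; have [_ ->] := cy; rewrite -yD -cmulA DD.
  rewrite -cmulBl -cmulBr; apply: le_lt_trans yp.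
  apply: le_trans (normr_cmul _ _) _; rewrite Dn mulr1.
  apply: norm_cmul_le1 => //; apply: norm_cmul_le1; first by rewrite Dn.
  have cn : `|c^†| <= 1 by rewrite norm_cstar; exact: (isometry_norm hv c_iso).
  by have := norm_cexp hv N ler01 cn; rewrite expr1n.
have [vv vs] := hv.
pose z := y - a *: v.
have zD : z ** D = 0.
  by rewrite /z cmulBl cmulZl yDa; have [-> _] := cD; rewrite subrr.
have Dz : D ** z = 0.
  rewrite /z cmulBr cmulZr -yD yDa; have [_ ->] := cD; rewrite subrr//.
have cz : corner v z.
  by rewrite /z -scaleNr; apply: cornerD => //; exact/cornerZ/corner_v.
have zc : z ** c = c ** z.
  by rewrite /z cmulBl cmulBr yc cmulZl cmulZr; have [-> ->] := cc.
have zsc : z^† ** c = c ** z^†.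
  have h : z ** c^† = c^† ** z.
    by rewrite /z cmulBl cmulBr ycs cmulZl cmulZr; have [-> ->] := cs.
  by rewrite -{1}[c]cstarK -cstarM -h cstarM cstarK.
have zsD : z^† ** D = 0 by rewrite -{1}Ds -cstarM Dz cstar0.
have zl : laurent z.
  by rewrite /z -scaleNr; apply: laurentD => //; exact/laurentZ/laurent_v.
have zsl : laurent z^†.
  rewrite /z cstarB cstarZ vs -scaleNr.
  by apply: laurentD => //; exact/laurentZ/laurent_v.
have czs := corner_star hv cz.
(* These combinations are self-adjoint; b = 1 and b = i give z + z^* = 0 and z - z^* = 0. *)
have z0 b : (b *: z + b^* *: z^†) = 0.
  apply: (laurent_self_adjoint_eq0 hv cc c_iso D_neq0).
  - by apply: cornerD; apply: cornerZ.
  - by rewrite cstarD !cstarZ conjCK cstarK addrC.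
  - by rewrite cmulDl cmulDr !cmulZl !cmulZr zc zsc.
  - by rewrite cmulDl !cmulZl zD zsD !scaler0 addr0.
  - by apply: laurentD; apply: laurentZ.
exists a; apply/eqP; rewrite -subr_eq0 -/z; apply/eqP.
have h1 := z0 1; have h2 := z0 'i.
rewrite conjC1 !scale1r in h1; rewrite conjCi in h2.
have zs : z^† = - z by apply/eqP; rewrite -addr_eq0 addrC h1.
move: h2; rewrite zs scaleNr scalerN opprK -scalerDl => /eqP.
rewrite scaler_eq0 => /orP[|/eqP//].
by rewrite -mulr2n mulrn_eq0/= (negbTE (neq0Ci _)).
Qed.

End ToeplitzScalar.

(** * Generators and dense subspace *)

Section SubalgebraCriteria.
Context {R : realType} {A : cstarAlgType R}.

Lemma closed_ker (f : A -> A) (K : R[i]) : 0 <= K ->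
  (forall x y, f (x - y) = f x - f y) -> (forall x, `|f x| <= K * `|x|) ->
  closed [set x | f x = 0].
Proof.
move=> K0 fB fK; apply: closedP => x h /=.
apply: (norm_le_eps K0) => e e0; have [y /= y0 xy] := h e e0.
rewrite -[f x]subr0 -y0 -fB; apply: le_trans (fK _) _.
by rewrite ler_wpM2l// ltW.
Qed.

Lemma subrACA (a b c d : A) : a - b - (c - d) = a - c - (b - d).
Proof. by rewrite !opprB addrACA [RHS]addrACA (addrC (- b)). Qed.

(** The condition on x^* makes the set stable under the involution for a z that need not be
    self-adjoint. *)
Lemma commutant_subalg (z : A) :
  cstar_subalg [set x | z ** x = x ** z /\ z ** x^† = x^† ** z].
Proof.
split.
- by rewrite /= cstar0 !cmul0l !cmul0r.
- move=> a x y [h1 h2] [h3 h4] /=.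
  rewrite cstarD cstarZ !cmulDl !cmulDr !cmulZl !cmulZr.
  by rewrite h1 h2 h3 h4.
- move=> x y [h1 h2] [h3 h4] /=; rewrite cstarM.
  by split; rewrite cmulA ?h1 ?h4 -cmulA ?h3 ?h2 cmulA.
- by move=> x [h1 h2] /=; rewrite cstarK.
- have -> : [set x | z ** x = x ** z /\ z ** x^† = x^† ** z] =
     [set x | z ** x - x ** z = 0] `&` [set x | z ** x^† - x^† ** z = 0].
    apply/seteqP; split => x /= [h1 h2]; first by rewrite h1 h2 !subrr.
    by split; apply/eqP; rewrite -subr_eq0 ?h1 ?h2.
  have bd w : `|z ** w - w ** z| <= 2 * `|z| * `|w|.
    apply: le_trans (ler_normB _ _) _.
    have -> : 2 * `|z| * `|w| = `|z| * `|w| + `|w| * `|z| by ring.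
    by rewrite lerD// normr_cmul.
  apply: closedI; apply: (@closed_ker _ (2 * `|z|)); rewrite ?mulr_ge0//.
  + by move=> x y; rewrite cmulBl cmulBr subrACA.
  + by move=> x y; rewrite cstarB cmulBl cmulBr subrACA.
  + by move=> x; rewrite -[X in _ * X]norm_cstar.
Qed.

Lemma unit_subalg (u : A) : u^† = u ->
  cstar_subalg [set x | u ** x = x /\ x ** u = x].
Proof.
move=> us; split.
- by rewrite /= !cmul0l !cmul0r.
- move=> a x y [h1 h2] [h3 h4] /=.
  by rewrite !cmulDl !cmulDr !cmulZl !cmulZr h1 h2 h3 h4.
- by move=> x y [h1 h2] [h3 h4] /=; rewrite cmulA h1 -cmulA h4.
- by move=> x [h1 h2] /=; split; rewrite -{1}us -cstarM ?h1 ?h2.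
- have -> : [set x | u ** x = x /\ x ** u = x] =
     [set x | u ** x - x = 0] `&` [set x | x ** u - x = 0].
    apply/seteqP; split => x /= [h1 h2]; first by rewrite h1 h2 !subrr.
    by split; apply/eqP; rewrite -subr_eq0 ?h1 ?h2.
  apply: closedI; apply: (@closed_ker _ (`|u| + 1)); rewrite ?addr_ge0//.
  + by move=> x y; rewrite cmulBr subrACA.
  + move=> x; apply: le_trans (ler_normB _ _) _; rewrite mulrDl mul1r.
    by rewrite lerD// normr_cmul.
  + by move=> x y; rewrite cmulBl subrACA.
  + move=> x; apply: le_trans (ler_normB _ _) _; rewrite mulrDl mul1r.
    by rewrite lerD// mulrC normr_cmul.
Qed.

Definition lin_closed (M : set A) : Prop :=
  M 0 /\ forall (a : R[i]) x y, M x -> M y -> M (a *: x + y).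

Lemma lin_span_ind (X M : set A) : lin_closed M -> X `<=` M -> lin_span X `<=` M.
Proof. by move=> Ml XM x; apply. Qed.

Lemma lin_span_closed (X : set A) : lin_closed (lin_span X).
Proof.
split; first by move=> M [[M0 _] _].
move=> a x y Mx My M [Ml XM]; apply: (proj2 Ml); first exact: Mx.
exact: My.
Qed.

Lemma sub_lin_span (X : set A) : X `<=` lin_span X.
Proof. by move=> x Xx M [_]; apply. Qed.

Lemma lin_closed_sum (M : set A) (I : Type) (r : seq I) (Q : pred I) (F : I -> A) :
  lin_closed M -> (forall i, Q i -> M (F i)) -> M (\sum_(i <- r | Q i) F i).
Proof.
move=> [M0 Ml] MF; apply: big_ind => // x y Mx My.
by rewrite -[x]scale1r; exact: Ml.
Qed.

Lemma lin_closedZ (M : set A) (a : R[i]) x : lin_closed M -> M x -> M (a *: x).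
Proof. by move=> [M0 Ml] Mx; rewrite -[a *: x]addr0; exact: Ml. Qed.

Lemma lin_closedD (M : set A) x y : lin_closed M -> M x -> M y -> M (x + y).
Proof. by move=> [M0 Ml] Mx My; rewrite -[x]scale1r; exact: Ml. Qed.

Lemma approx_lin (M : set A) : lin_closed M -> lin_closed (approx M).
Proof.
move=> Ml; split; first by apply: sub_approx; case: Ml.
move=> a x y Mx My; apply: approx_add => //.
  by move=> u w; exact: lin_closedD.
apply: (approx_linear (f := fun w => a *: w) (K := `|a|) (M := M)) => //.
  by move=> u w; rewrite -scalerBr normrZ.
by move=> u Mu; apply: sub_approx; exact: lin_closedZ.
Qed.

Lemma lin_closed_preim (M : set A) (f : A -> A) : lin_closed M ->
  (forall (a : R[i]) x y, f (a *: x + y) = a *: f x + f y) ->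
  lin_closed [set x | M (f x)].
Proof.
move=> [M0 Ml] fl; split => /=.
  have := fl (-1) 0 0; rewrite scaler0 addr0 scaleN1r addNr => ->//.
by move=> a x y Mx My; rewrite fl; exact: Ml.
Qed.

End SubalgebraCriteria.

(** * Density of the span of the monomials S_p S_q^* *)

Section CuntzKriegerAlgebra.
Context {R : realType} {G : fin_digraph} {A : cstarAlgType R}.
Variables (P : vert G -> A) (S : edge G -> A).
Hypothesis CK : CK_family P S.
Hypothesis gen : cstar_gen (range P `|` range S) = setT.
Implicit Types (v w : vert G) (e f : edge G) (es : seq (edge G)) (p q : prepath G).

Lemma CK_ind (M : set A) : cstar_subalg M ->
  (forall v, M (P v)) -> (forall e, M (S e)) -> forall a, M a.
Proof.
move=> MA MP MS a; have : [set: A] a by []; rewrite -gen; apply; split => //.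
by move=> _ [[v _ <-]|[e _ <-]].
Qed.

Lemma PP v w : P v ** P w = if v == w then P v else 0.
Proof.
case: eqVneq => [->|vw]; last exact: (CK_orth CK).
by have [] := CK_proj CK w.
Qed.

Lemma Pstar v : (P v)^† = P v. Proof. by have [] := CK_proj CK v. Qed.

Lemma PS v e : P v ** S e = if v == src e then S e else 0.
Proof.
rewrite -{1}(CK_src CK) cmulA PP; case: eqVneq => [->|_]; first exact: (CK_src CK).
exact: cmul0l.
Qed.

Lemma SP v e : S e ** P v = if v == rng e then S e else 0.
Proof.
rewrite -{1}(CK_rng CK) -cmulA PP eq_sym; case: eqVneq => [_|_]; first exact: (CK_rng CK).
exact: cmul0r.
Qed.

Lemma PSs v e : P v ** (S e)^† = if v == rng e then (S e)^† else 0.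
Proof. by rewrite -(Pstar v) -cstarM SP; case: ifP; rewrite ?cstar0. Qed.

Lemma SsP v e : (S e)^† ** P v = if v == src e then (S e)^† else 0.
Proof. by rewrite -(Pstar v) -cstarM PS; case: ifP; rewrite ?cstar0. Qed.

Lemma SsS e f : (S e)^† ** S f = if e == f then P (rng e) else 0.
Proof. exact: (CK_star CK). Qed.

Definition CK_unit : A := \sum_v P v.

Lemma CK_unitP a : CK_unit ** a = a /\ a ** CK_unit = a.
Proof.
apply: (@CK_ind [set x | CK_unit ** x = x /\ x ** CK_unit = x]).
- by apply: unit_subalg; rewrite cstar_sum; apply: eq_bigr => v _; exact: Pstar.
- move=> v; rewrite /CK_unit /= cmul_suml cmul_sumr; split.
    rewrite (bigD1 v)//= PP eqxx big1 ?addr0// => w wv.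
    by rewrite PP (negbTE wv).
  rewrite (bigD1 v)//= PP eqxx big1 ?addr0// => w wv.
  by rewrite PP eq_sym (negbTE wv).
- move=> e; rewrite /CK_unit /= cmul_suml cmul_sumr; split.
    rewrite (bigD1 (src e))//= PS eqxx big1 ?addr0// => w wv.
    by rewrite PS (negbTE wv).
  rewrite (bigD1 (rng e))//= SP eqxx big1 ?addr0// => w wv.
  by rewrite SP (negbTE wv).
Qed.

Lemma central_gen (z : A) : (forall v, z ** P v = P v ** z) ->
  (forall e, z ** S e = S e ** z) -> (forall e, z ** (S e)^† = (S e)^† ** z) ->
  center_of [set: A] z.
Proof.
move=> zP zS zSs; split => // x _; suff [] : z ** x = x ** z /\ z ** x^† = x^† ** z by [].
move: x; apply: CK_ind; first exact: commutant_subalg.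
  by move=> v; split; rewrite ?Pstar; exact: zP.
by move=> e; split; [exact: zS | exact: zSs].
Qed.

Local Notation pe := (path_elt P S).

Lemma pe0 v : pe (v, [::]) = P v. Proof. by []. Qed.

(** [path_elt] folds from the left, whereas inductions on paths remove the first edge; for a single
    edge the extra P (rng e) is absorbed. *)
Lemma pe_cons v e es : pe (v, e :: es) = S e ** pe (rng e, es).
Proof.
rewrite /path_elt /=; case: es => [|f es] /=; first by rewrite (CK_rng CK).
elim: es f => //= g es IH f.
have foldA x y (r : seq (edge G)) :
    foldl (fun x f => x ** S f) (x ** y) r = x ** foldl (fun x f => x ** S f) y r.
  by elim: r y => //= h r IHr y; rewrite -cmulA IHr.
by rewrite -foldA cmulA.
Qed.

Lemma P_pe w v es : chain v es -> P w ** pe (v, es) = if w == v then pe (v, es) else 0.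
Proof.
case: es => [|e es] /=; first by rewrite !pe0 PP; case: eqP => // ->.
move=> /andP[/eqP <- _]; rewrite pe_cons cmulA PS; case: ifP => // _.
exact: cmul0l.
Qed.

Lemma pe_P w p : pe p ** P w = if w == path_rng p then pe p else 0.
Proof.
case: p => v es; rewrite /path_rng /=; elim: es v => [|e es IH] v /=.
  by rewrite !pe0 PP eq_sym; case: eqP => // ->.
by rewrite pe_cons -cmulA IH; case: ifP => // _; exact: cmul0r.
Qed.

Lemma pe_star_P w v es : chain v es ->
  (pe (v, es))^† ** P w = if w == v then (pe (v, es))^† else 0.
Proof. by move=> c; rewrite -(Pstar w) -cstarM P_pe//; case: ifP; rewrite ?cstar0. Qed.

Lemma P_pe_star w p : P w ** (pe p)^† = if w == path_rng p then (pe p)^† else 0.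
Proof. by rewrite -(Pstar w) -cstarM pe_P; case: ifP; rewrite ?cstar0. Qed.

Definition monomials : set A := [set a | exists p q,
  [/\ is_path p, is_path q, path_rng p = path_rng q & a = pe p ** (pe q)^†]].

Definition poly_part : set A := lin_span monomials.

(** If the ranges differ, orthogonal projections meet in the middle and the product is 0. *)
Lemma mono_in p q : is_path p -> is_path q -> poly_part (pe p ** (pe q)^†).
Proof.
move=> hp hq; have [pq|pq] := eqVneq (path_rng p) (path_rng q).
  by apply: sub_lin_span; exists p, q.
have := pe_P (path_rng p) p; rewrite eqxx => <-.
rewrite -cmulA P_pe_star (negbTE pq) cmul0r.
by case: (lin_span_closed monomials).
Qed.

Lemma poly_mulP w x : poly_part x -> poly_part (P w ** x).
Proof.
apply: (@lin_span_ind _ _ _ [set x | poly_part (P w ** x)]).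
  apply: lin_closed_preim; first exact: lin_span_closed.
  by move=> a y z; rewrite cmulDr cmulZr.
move=> _ [[v es] [q [hp hq pq ->]]] /=; rewrite cmulA P_pe//.
case: ifP => _; first exact: mono_in.
by rewrite cmul0l; case: (lin_span_closed monomials).
Qed.

Lemma poly_mulS e x : poly_part x -> poly_part (S e ** x).
Proof.
apply: (@lin_span_ind _ _ _ [set x | poly_part (S e ** x)]).
  apply: lin_closed_preim; first exact: lin_span_closed.
  by move=> a y z; rewrite cmulDr cmulZr.
move=> _ [[v es] [q [hp hq pq ->]]] /=; rewrite cmulA.
have [rv|rv] := eqVneq (rng e) v.
  rewrite -rv -(pe_cons (src e)); apply: mono_in => //.
  by rewrite /is_path /= eqxx rv.
rewrite -[S e](CK_rng CK) -(cmulA (S e)) P_pe// (negbTE rv) cmul0r cmul0l.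
by case: (lin_span_closed monomials).
Qed.

Lemma poly_mulSs e x : poly_part x -> poly_part ((S e)^† ** x).
Proof.
apply: (@lin_span_ind _ _ _ [set x | poly_part ((S e)^† ** x)]).
  apply: lin_closed_preim; first exact: lin_span_closed.
  by move=> a y z; rewrite cmulDr cmulZr.
move=> _ [[v [|f es]] [q [hp hq pq ->]]] /=; rewrite cmulA.
  rewrite pe0 SsP; case: eqP => [ve|_]; last first.
    by rewrite cmul0l; case: (lin_span_closed monomials).
  case: q hq pq => w fs hq pq.
  (* Here p is a vertex, so S_e^* finds no edge to cancel and lengthens q by e at its end. *)
  have -> : (S e)^† ** (pe (w, fs))^† = pe (rng e, [::]) ** (pe (w, rcons fs e))^†.
    rewrite -cstarM pe0.
    have -> : pe (w, rcons fs e) = pe (w, fs) ** S e.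
      move: hq pq => _ /=; rewrite /path_rng /= ve.
      elim: fs w => [|g fs IH] w /=; first by move=> <-; rewrite pe_cons !pe0 SP eqxx PS eqxx.
      by move=> h; rewrite !pe_cons IH// cmulA.
    by rewrite [in RHS]cstarM cmulA PSs eqxx -cstarM.
  apply: mono_in => //; move: hq pq; rewrite /is_path /path_rng /= ve.
  elim: fs w => [|g fs IH] w /=; first by move=> _ ->; rewrite eqxx.
  by move=> /andP[-> h] /= h2; exact: IH.
rewrite pe_cons cmulA SsS; case: ifP => [/eqP ->|_]; last first.
  by rewrite !cmul0l; case: (lin_span_closed monomials).
move: hp; rewrite /is_path /= => /andP[_ hp].
by rewrite P_pe// eqxx; exact: mono_in.
Qed.

(* The elements whose left multiplication, and that of their adjoint, preserves the
   closure of [poly_part] form a C*-subalgebra containing the generators. *)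
Lemma poly_dense a : approx poly_part a.
Proof.
have al : lin_closed (approx poly_part) by apply: approx_lin; exact: lin_span_closed.
have lip (b : A) : (forall x, poly_part x -> poly_part (b ** x)) ->
    forall x, approx poly_part x -> approx poly_part (b ** x).
  move=> bP; apply: (approx_linear (f := fun x => b ** x) (K := `|b|)) => //.
    by move=> x y; rewrite -cmulBr; exact: normr_cmul.
  by move=> x /bP; exact: sub_approx.
pose M := [set b : A | forall x, approx poly_part x ->
  approx poly_part (b ** x) /\ approx poly_part (b^† ** x)].
have : M a.
  apply: (@CK_ind M).
  - split.
    + move=> x _; rewrite cstar0 cmul0l; by split; case: al.
    + move=> c x y Mx My w aw; have [h1 h2] := Mx w aw; have [h3 h4] := My w aw.
      rewrite cstarD cstarZ !cmulDl !cmulZl.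
      by split; apply: (proj2 al).
    + move=> x y Mx My w aw; rewrite cstarM -!cmulA; split.
        by apply: (proj1 (Mx _ _)); exact: (proj1 (My _ _)).
      by apply: (proj2 (My _ _)); exact: (proj2 (Mx _ _)).
    + by move=> x Mx w aw; rewrite cstarK; have [] := Mx w aw.
    + apply: closedP => x h w aw; have w1 : 0 < `|w| + 1 by rewrite ltr_wpDl.
      split; apply: (closed_approx (@approx_closed _ _ _)) => e e0;
      have [y /(_ w aw)[y1 y2] xy] := h _ (divr_gt0 e0 w1).
        exists (y ** w) => //; rewrite -cmulBl.
        apply: le_lt_trans (normr_cmul _ _) _.
        apply: (@le_lt_trans _ _ (e / (`|w| + 1) * `|w|)).
          by rewrite ler_wpM2r// ltW.
        by rewrite mulrAC ltr_pdivrMr// ltr_pM2l// ltrDl.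
      exists (y^† ** w) => //; rewrite -cmulBl -cstarB.
      apply: le_lt_trans (normr_cmul _ _) _; rewrite norm_cstar.
      apply: (@le_lt_trans _ _ (e / (`|w| + 1) * `|w|)).
        by rewrite ler_wpM2r// ltW.
      by rewrite mulrAC ltr_pdivrMr// ltr_pM2l// ltrDl.
  - by move=> v x ax; rewrite Pstar; split; apply: lip => // y; exact: poly_mulP.
  - by move=> e x ax; split; apply: lip => // y; [exact: poly_mulS | exact: poly_mulSs].
(* Membership in M concerns left multiplication; applied to the unit, itself in [poly_part], it
   gives a. *)
move=> /(_ CK_unit)[].
  apply: sub_approx; apply: (@lin_closed_sum _ _ poly_part).
    exact: (lin_span_closed monomials).
  move=> v _; have -> : P v = pe (v, [::]) ** (pe (v, [::]))^† by rewrite pe0 Pstar PP eqxx.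
  exact: mono_in.
by have [_ ->] := CK_unitP a.
Qed.

End CuntzKriegerAlgebra.

(** * Cycles with an exit *)

Section CycleWithExit.
Context {R : realType} {G : fin_digraph} {A : cstarAlgType R}.
Variables (P : vert G -> A) (S : edge G -> A).
Hypothesis CK : CK_family P S.
Hypothesis gen : cstar_gen (range P `|` range S) = setT.
Hypothesis P_neq0 : forall v, P v != 0.
Implicit Types (v w : vert G) (e f : edge G) (es : seq (edge G)) (p q : prepath G).
Local Notation pe := (path_elt P S).
Variables (e0 : edge G) (C' : seq (edge G)).
Local Notation C := (e0 :: C').
Hypothesis Ccycle : is_cycle C.
Local Notation n := (size C).

(** Indices are read modulo n, so that winding round the cycle any number of times is plain
    addition. *)
Definition cyc i := nth e0 C (i %% n).
Definition cycv i := src (cyc i).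

Lemma cyc_in i : cyc i \in C.
Proof. by rewrite mem_nth// ltn_mod. Qed.

Lemma C_uniq : uniq C.
Proof. by have [_ _ /map_uniq] := Ccycle. Qed.

Lemma cyc_next i : rng (cyc i) = cycv i.+1.
Proof.
have [_ cC _] := Ccycle.
have := next_cycle cC (cyc_in i) => /eqP ->; congr src.
have im : (i %% n < n)%N by rewrite ltn_mod.
rewrite next_nth cyc_in /cyc index_uniq ?C_uniq// modnS.
(* At the last edge [next_nth] runs off the tail C' and returns its default e0, which is the first
   edge, as the wrap-around requires. *)
have [iN|iN] := eqVneq (i %% n).+1 n.
  have -> : (n %| i.+1)%N by rewrite /dvdn -addn1 -modnDml addn1 iN modnn.
  by rewrite nth_default//= -ltnS iN.
have iN' : ((i %% n).+1 < n)%N by rewrite ltn_neqAle iN.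
have -> : (n %| i.+1)%N = false.
  by rewrite /dvdn -addn1 -modnDml addn1 modn_small.
by [].
Qed.

Lemma cycv_inj i j : cycv i = cycv j -> i = j %[mod n].
Proof.
have [_ _ uC] := Ccycle.
have im k : (k %% n < size (map src C))%N by rewrite size_map ltn_mod.
move=> h; apply/eqP; rewrite -(nth_uniq (src e0) (im i) (im j) uC).
by rewrite !(nth_map e0) ?ltn_mod//; apply/eqP.
Qed.

Lemma cyc_mod i j : i = j %[mod n] -> cyc i = cyc j.
Proof. by rewrite /cyc => ->. Qed.

Fixpoint cpath i k : A := if k is k'.+1 then S (cyc i) ** cpath i.+1 k' else P (cycv i).

Lemma cpath_mod i j k : i = j %[mod n] -> cpath i k = cpath j k.
Proof.
elim: k i j => [|k IH] i j ij /=; first by rewrite /cycv (cyc_mod ij).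
by rewrite (cyc_mod ij) (IH i.+1 j.+1)// -addn1 -modnDml ij modnDml addn1.
Qed.

Lemma P_cpath i k : P (cycv i) ** cpath i k = cpath i k.
Proof.
by case: k => [|k] /=; rewrite ?(PP CK) ?eqxx// cmulA (PS CK) eqxx.
Qed.

Lemma cpathD i k l : cpath i (k + l) = cpath i k ** cpath (i + k) l.
Proof.
elim: k i => [|k IH] i /=; first by rewrite addn0 P_cpath.
by rewrite IH cmulA addSnnS.
Qed.

Lemma cpath_P i k : cpath i k ** P (cycv (i + k)) = cpath i k.
Proof.
elim: k i => [|k IH] i /=; first by rewrite addn0 (PP CK) eqxx.
by rewrite -cmulA -addSnnS IH.
Qed.

Lemma cpath_iso i k : (cpath i k)^† ** cpath i k = P (cycv (i + k)).
Proof.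
elim: k i => [|k IH] i /=; first by rewrite addn0 (Pstar CK) (PP CK) eqxx.
rewrite cstarM -cmulA (cmulA (S _)^†) (SsS CK) eqxx cyc_next.
by rewrite P_cpath IH addSnnS.
Qed.

(** Either the path follows the cycle, and its adjoint cancels an initial segment, or it deviates at
    some edge, where e^* f = 0 kills the product. *)
Lemma pe_star_cpath i es : chain (cycv i) es ->
  (forall l, (pe (cycv i, es))^† ** cpath i (size es + l) = 0) \/
  (path_rng (cycv i, es) = cycv (i + size es) /\
   forall l, (pe (cycv i, es))^† ** cpath i (size es + l) = cpath (i + size es) l).
Proof.
elim: es i => [|e es IH] i /=.
  by right; rewrite addn0; split => // l; rewrite pe0 (Pstar CK) P_cpath.
move=> /andP[/eqP se ch].
have E l : (pe (cycv i, e :: es))^† ** (S (cyc i) ** cpath i.+1 (size es + l)) =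
   (pe (rng e, es))^† ** ((S e)^† ** S (cyc i)) ** cpath i.+1 (size es + l).
  by rewrite (pe_cons CK) cstarM !cmulA.
have [ei|ei] := eqVneq e (cyc i); last first.
  by left => l; rewrite E (SsS CK) (negbTE ei) cmul0r cmul0l.
have re : rng e = cycv i.+1 by rewrite ei cyc_next.
rewrite re in ch; have [h|[h1 h2]] := IH _ ch; [left => l|right; split => [|l]].
- by rewrite E (SsS CK) -ei eqxx re (pe_star_P CK) ?eqxx// h.
- by rewrite /path_rng /= re -addSnnS -h1.
- by rewrite E (SsS CK) -ei eqxx re (pe_star_P CK) ?eqxx// h2 addSnnS.
Qed.

Definition cyc_elt : A := cpath 0 n.
Local Notation c := cyc_elt.
Local Notation v0 := (src e0).

Lemma cycv0 : cycv 0 = v0.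
Proof. by rewrite /cycv /cyc mod0n. Qed.

Lemma P_proj v : projection (P v). Proof. exact: (CK_proj CK). Qed.

Lemma cyc_elt_iso : c^† ** c = P v0.
Proof. by rewrite cpath_iso add0n -cycv0 /cycv /cyc modnn mod0n. Qed.

Lemma cyc_elt_corner : corner (P v0) c.
Proof.
split; first by rewrite -cycv0 P_cpath.
have := cpath_P 0 n; rewrite add0n.
by have -> : cycv n = v0 by rewrite -cycv0 /cycv /cyc modnn mod0n.
Qed.

Lemma cyc_eltX k : cexp (P v0) c k = cpath 0 (n * k).
Proof.
elim: k => [|k IH]; first by rewrite cexp0 muln0 /= cycv0.
rewrite cexpS IH mulnS cpathD add0n; congr (_ ** _).
by apply: cpath_mod; rewrite modnn mod0n.
Qed.

(** Let x follow the cycle up to the source of the exit and then take the exit. Then c^* x = 0, so D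
    x = x, while x^* x = P (rng e) is nonzero. *)
Lemma defect_neq0 e : exit_of C e -> P v0 - c ** c^† != 0.
Proof.
move=> [/= /mapP[f fC ef] eC].
have {}ef : src e = cycv (index f C).
  by rewrite /cycv /cyc modn_small ?index_mem// nth_index.
set i := index f C in ef; have iN : (i < n)%N by rewrite index_mem.
pose x := cpath 0 i ** S e.
have xx : x^† ** x = P (rng e).
  rewrite /x cstarM -cmulA (cmulA (cpath 0 i)^†) cpath_iso add0n.
  by rewrite (PS CK) ef eqxx (SsS CK) eqxx.
have cx : c^† ** x = 0.
  rewrite /x /c -(subnKC iN) addSnnS cpathD add0n /= cstarM -!cmulA.
  rewrite (cmulA (cpath 0 i)^†) cpath_iso add0n (PS CK) ef eqxx.
  rewrite cstarM -cmulA (SsS CK).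
  case: eqP => [h|_]; last by rewrite cmul0r.
  by rewrite -h cyc_in in eC.
apply/eqP => D0; have := P_neq0 (rng e); rewrite -xx => /eqP; apply.
have -> : x = (P v0 - c ** c^†) ** x; last by rewrite D0 cmul0l cmul0r.
rewrite cmulBl -(cmulA c) cx cmul0r subr0 /x cmulA.
by rewrite -cycv0 P_cpath.
Qed.

Lemma compressed_monomial p q M N : is_path p -> is_path q ->
  path_rng p = path_rng q ->
  (size p.2 <= M)%N -> (M + size q.2 <= N)%N ->
  exists g, (cexp (P v0) c M)^† ** (pe p ** (pe q)^†) ** cexp (P v0) c N = ev (P v0) c g.
Proof.
case: p q => v es [w fs]; rewrite /is_path /= => hp hq pq pM qN.
rewrite !cyc_eltX.
have zero : exists g, (0 : A) = ev (P v0) c g by exists 0; rewrite ev0.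
have comp k : P v0 ** cpath 0 k = cpath 0 k by rewrite -cycv0 P_cpath.
have [v_v0|vv0] := eqVneq v0 v; last first.
  have -> : (cpath 0 (n * M))^† ** (pe (v, es) ** (pe (w, fs))^†) = 0.
    rewrite -comp cstarM (Pstar CK) -cmulA (cmulA (P v0)) (P_pe CK)//.
    by rewrite (negbTE vv0) cmul0l cmul0r.
  by rewrite cmul0l.
have [w_v0|wv0] := eqVneq v0 w; last first.
  rewrite -cmulA.
  have -> : (pe (v, es) ** (pe (w, fs))^†) ** cpath 0 (n * N) = 0 :> A.
    rewrite -comp cmulA -(cmulA (pe (v, es))) (pe_star_P CK)//.
    by rewrite (negbTE wv0) cmul0r cmul0l.
  by rewrite cmul0r.
have n0 : (0 < n)%N by [].
rewrite -v_v0 -w_v0 -cycv0 in hp hq pq *.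
set a := size es in pM; set b := size fs in qN.
have aM : (a + (n * M - a) = n * M)%N by rewrite subnKC// (leq_trans pM)// leq_pmull.
have bN : (b + (n * N - b) = n * N)%N.
  by rewrite subnKC// (leq_trans (leq_trans (leq_addl _ _) qN))// leq_pmull.
rewrite -{1}aM -{1}bN cmulA -(cmulA _ _ (cpath 0 _)) -[pe (cycv 0, es)]cstarK -cstarM.
have [h|[pr h]] := pe_star_cpath hp; first by rewrite h cstar0 cmul0l; exact: zero.
have [h'|[qr h']] := pe_star_cpath hq; first by rewrite h' cmul0r; exact: zero.
rewrite h h' -/a -/b !add0n; rewrite pr qr -/a -/b !add0n in pq.
(* Both paths follow the cycle from v0 and end at the same vertex, so their lengths agree modulo n;
   hence n divides l2 - l1. *)
have ab : a = b %[mod n] by apply: cycv_inj.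
rewrite -(cpath_mod _ ab).
set l1 := (n * M - a)%N in aM *; set l2 := (n * N - b)%N in bN *.
have l12 : (l1 <= l2)%N.
  have : (n * M + n * b <= n * N)%N by rewrite -mulnDr leq_mul2l qN orbT.
  have : (b <= n * b)%N by rewrite leq_pmull.
  by rewrite /l1 /l2; lia.
rewrite -(subnKC l12) cpathD cmulA cpath_iso P_cpath aM.
have -> : cpath (n * M) (l2 - l1) = cpath 0 (l2 - l1).
  by apply: cpath_mod; rewrite modnMr mod0n.
have /dvdnP[k ->] : (n %| l2 - l1)%N.
  have E : (b + (n * M + (l2 - l1)) = a + n * N)%N by rewrite -aM -bN; lia.
  have := congr1 (modn^~ n) E.
  rewrite -[in RHS]modnDml ab modnDml => /eqP; rewrite eqn_modDl.
  by rewrite modnMr -modnDml modnMr add0n.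
by exists 'X^k; rewrite evXn cyc_eltX mulnC.
Qed.

Lemma compressed_poly x : poly_part P S x ->
  exists K, forall M N, (K <= M)%N -> (M + K <= N)%N ->
  exists g, (cexp (P v0) c M)^† ** x ** cexp (P v0) c N = ev (P v0) c g.
Proof.
apply: (@lin_span_ind _ _ _ [set x | exists K, forall M N, (K <= M)%N -> (M + K <= N)%N ->
  exists g, (cexp (P v0) c M)^† ** x ** cexp (P v0) c N = ev (P v0) c g]).
  split => [|a y z [K yK] [L zL]].
    by exists 0%N => M N _ _; exists 0; rewrite cmul0r cmul0l ev0.
  exists (K + L)%N => M N KM MN.
  have [||g gP] := yK M N; [lia|lia|]; have [||h hP] := zL M N; [lia|lia|].
  exists (a *: g + h); rewrite evD evZ -gP -hP.
  by rewrite cmulDr cmulDl cmulZr cmulZl.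
move=> _ [p [q [hp hq pq ->]]]; exists (size p.2 + size q.2)%N => M N KM MN.
by apply: compressed_monomial => //; lia.
Qed.

(* As y is central, y c^K = c^*K y c^(2K), where y may be approximated by an
   element of [poly_part]. *)
Lemma central_laurent y : center_of [set: A] y -> laurent (P v0) c (y ** P v0).
Proof.
move=> [_ yc] e e_gt0; have [x xp yx] := poly_dense CK gen y e_gt0.
have [K KP] := compressed_poly xp.
have [g gP] := KP K (K + K)%N (leqnn _) (leqnn _).
exists K, g; rewrite -gP.
have cc := cyc_elt_corner; have hv := P_proj v0.
have cK := cexp_iso hv cc cyc_elt_iso K; rewrite -(cexp_star hv)// in cK.
have -> : y ** P v0 ** cexp (P v0) c K =
   (cexp (P v0) c K)^† ** y ** cexp (P v0) c (K + K).
  by rewrite -(yc (cexp (P v0) c K)^†)// -[in RHS]cmulA cexpD// (cmulA (cexp (P v0) c K)^†) cK cmulA.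
rewrite -cmulBl -cmulBr.
have cn : `|cexp (P v0) c K| <= 1.
  by have := norm_cexp hv K ler01 (isometry_norm hv cyc_elt_iso); rewrite expr1n.
have cn2 : `|cexp (P v0) c (K + K)| <= 1.
  by have := norm_cexp hv (K + K) ler01 (isometry_norm hv cyc_elt_iso); rewrite expr1n.
apply: le_lt_trans yx; apply: le_trans (normr_cmul _ _) _.
rewrite -[leRHS]mulr1 ler_pM//; apply: norm_cmul_le1 => //.
by rewrite norm_cstar.
Qed.

Lemma center_star y : center_of [set: A] y -> center_of [set: A] y^†.
Proof.
move=> [_ yc]; split => // x _.
by rewrite -[x]cstarK -!cstarM yc.
Qed.

Lemma cycle_with_exit_scalar y : center_of [set: A] y ->
  (exists e, exit_of C e) -> exists a, y ** P v0 = a *: P v0.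
Proof.
move=> yC [e eC]; have [_ yc] := yC.
have hv := P_proj v0; have [vv vs] := hv; have cc := cyc_elt_corner.
apply: (laurent_commutant_scalar hv cc cyc_elt_iso (defect_neq0 eC)).
- by split; rewrite -?cmulA ?vv// cmulA -yc// -cmulA vv.
- by rewrite -(cmulA y) (proj1 cc) (cmulA c y) -(yc c)// -(cmulA y c) (proj2 cc).
- have cs := corner_star hv cc.
  by rewrite -(cmulA y) (proj1 cs) (cmulA c^† y) -(yc c^†)// -(cmulA y c^†) (proj2 cs).
- exact: central_laurent.
- have -> : (y ** P v0)^† = y^† ** P v0.
    by rewrite cstarM vs; have [_ ->] := center_star yC.
  exact/central_laurent/center_star.
Qed.

End CycleWithExit.

(** * Walks in finite graphs *)

Section GraphWalks.
Variable G : fin_digraph.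
Implicit Types (u v w : vert G) (e : edge G) (C : seq (edge G)) (W : set (vert G)).

Definition adj : rel (vert G) := fun u w => [exists e : edge G, (src e == u) && (rng e == w)].

Lemma adj_edge e : adj (src e) (rng e).
Proof. by apply/existsP; exists e; rewrite !eqxx. Qed.

Lemma chain_path v es : chain v es -> path adj v (map rng es).
Proof.
elim: es v => //= e es IH v /andP[/eqP <- ch].
by rewrite adj_edge IH.
Qed.

Lemma path_chain v s : path adj v s -> exists2 es, chain v es & map rng es = s.
Proof.
elim: s v => [|w s IH] v /=; first by exists [::].
move=> /andP[/existsP[e /andP[/eqP <- /eqP <-]] /IH [es ch <-]].
by exists (e :: es) => //=; rewrite eqxx.
Qed.

Lemma descendantP v w : descendant v w <-> connect adj v w.
Proof.
split=> [[[u es] [hp]]|/connectP[s /path_chain[es ch <-] ->]].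
  rewrite /path_src /path_rng /= => uv <-; subst u.
  by apply/connectP; exists (map rng es) => //; exact: chain_path.
by exists (v, es).
Qed.

Lemma descendant_trans u v w : descendant u v -> descendant v w -> descendant u w.
Proof. rewrite !descendantP; exact: connect_trans. Qed.

Lemma descendant_edge e : descendant (src e) (rng e).
Proof. exact/descendantP/connect1/adj_edge. Qed.

Lemma hereditaryP W : (forall e, W (src e) -> W (rng e)) -> hereditary W.
Proof.
move=> hW w u Ww [[x es] [hp]]; rewrite /path_src /path_rng /= => xw <-; subst x.
elim: es w hp Ww => //= e es IH w; rewrite /is_path /= => /andP[/eqP <- ch] /hW.
exact: IH.
Qed.

Definition on_cycle v := exists2 C, is_cycle C & cycle_vert C v.

(** [is_cycle] wants distinct sources, so the walk is made loop-free before v -> u closes it; an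
    edge is then picked from each vertex to its successor. *)
Lemma closed_walk_cycle u v : adj v u -> connect adj u v -> on_cycle v.
Proof.
move=> vu /connectP[s' p' vl].
move: vl; case/shortenP: p' => s ps us _ vl {s'}.
pose vs := u :: s.
have cvs : cycle adj vs by rewrite /vs /= rcons_path ps -vl vu.
have [edef _] := existsP vu.
pose ed x y := if [pick e : edge G | (src e == x) && (rng e == y)] is Some e then e else edef.
have edP x y : adj x y -> src (ed x y) = x /\ rng (ed x y) = y.
  move=> /existsP[e exy]; rewrite /ed; case: pickP => [f /andP[/eqP <- /eqP <-]//|/(_ e)].
  by rewrite exy.
pose h x := ed x (next vs x).
have hP x : x \in vs -> src (h x) = x /\ rng (h x) = next vs x.
  by move=> xs; apply: edP; exact: next_cycle.
have srch : map src (map h vs) = vs.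
  by rewrite -map_comp map_id_in// => x /hP[].
exists (map h vs); last by rewrite /cycle_vert /mkset srch vl mem_last.
split => //; last by rewrite srch.
rewrite cycle_map; apply: cycle_from_next => // x xs /=.
have [_ ->] := hP _ xs.
have nxs : next vs x \in vs by rewrite mem_next.
by have [-> _] := hP _ nxs.
Qed.

(** The isometry of a cycle is based at the source of its first edge; rotating moves the base to v
    and keeps the edge set, hence the exits. *)
Lemma cycle_rot C v : is_cycle C -> cycle_vert C v ->
  exists e0 C', [/\ is_cycle (e0 :: C'), src e0 = v & e0 :: C' =i C].
Proof.
move=> [C0 cC uC] /mapP[e eC ->]; have [i C' E] := rot_to eC.
exists e, C'; split => //.
  by split; rewrite // -E ?rot_cycle// map_rot rot_uniq.
by move=> x; rewrite -E mem_rot.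
Qed.

Lemma cycle_edge_next C e : is_cycle C -> e \in C -> cycle_vert C (rng e).
Proof.
move=> [_ cC _] eC; have /eqP -> := next_cycle cC eC.
by rewrite /cycle_vert /= map_f// mem_next.
Qed.

Lemma cycle_connected C u v : is_cycle C -> cycle_vert C u -> cycle_vert C v ->
  descendant u v.
Proof.
move=> hC uC vC; have [e0 [C' [hC' e0u CC]]] := cycle_rot hC uC.
have [_ /= cC _] := hC'.
have {}vC : v \in map src (e0 :: C') by rewrite (eq_mem_map _ CC).
apply/descendantP; rewrite -e0u.
have pC : path adj (src e0) (map src C').
  rewrite path_map; move: cC; rewrite rcons_path => /andP[pC _].
  by apply: sub_path pC => x y /= /eqP <-; exact: adj_edge.
by move: vC => /=; exact: path_connect pC v.
Qed.

Lemma NE_cycle_hereditary C : NE_cycle C -> hereditary (cycle_vert C).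
Proof.
move=> [hC noexit]; apply: hereditaryP => e eC.
apply: (cycle_edge_next hC); apply: contra_notT noexit => eNC.
by exists e.
Qed.

Lemma finite_bounded_paths (k : nat) : finite_set [set p : prepath G | (size p.2 <= k)%N].
Proof.
(* Edge lists of length at most k are encoded as k-tuples of options, padded with [None]. *)
pose F (x : vert G * (k.-tuple (option (edge G)))) : prepath G :=
  (x.1, pmap id x.2).
apply: (@sub_finite_set _ _ (F @` setT)); last first.
  by apply: finite_image; exact: finite_finset.
move=> [v es] /= es_k.
have sz : size (map Some es ++ nseq (k - size es) None) == k.
  by rewrite size_cat size_map size_nseq subnKC.
exists (v, Tuple sz) => //; rewrite /F /= pmap_cat; congr (_, _).
have -> : pmap id (nseq (k - size es) (@None (edge G))) = [::].
  by elim: (k - size es)%N.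
by rewrite cats0 map_pK.
Qed.

(** Without such a v, an arrival path never repeats a vertex before entering W, so its length is at
    most the number of vertices. *)
Lemma infinite_Arr W : ~ finite_set (Arr W) ->
  exists v, [/\ ~ W v, on_cycle v & exists2 w, W w & descendant v w].
Proof.
move=> infW; apply: contrapT => h; apply: infW.
apply: (sub_finite_set _ (finite_bounded_paths #|vert G|)) => -[v es] [] /=.
rewrite /is_path /path_rng /= => ch Wr avoid.
suff us : uniq (belast v (map rng es)).
  by rewrite -(size_map rng) -(size_belast v) -(card_uniqP us) max_card.
have pth := chain_path ch.
elim: es v {ch} pth Wr avoid => //= e es IH v /andP[ve pth] Wr avoid.
rewrite IH// ?andbT; last by move=> u uin; apply: avoid; rewrite inE uin orbT.
apply/negP => vin; apply: h; exists v; split.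
- by apply: avoid; rewrite inE eqxx.
- apply: (closed_walk_cycle ve); apply: path_connect pth _ _.
  exact: mem_belast.
- exists (last (rng e) (map rng es)) => //; apply/descendantP.
  apply: connect_trans (connect1 ve) _; apply: path_connect pth _ _.
  exact: mem_last.
Qed.

(** A successor map that stays in N must revisit a vertex, by the pigeonhole principle. *)
Lemma persistent_cycle (N : set (vert G)) v : N v ->
  (forall w, N w -> exists2 e, src e = w & N (rng e)) -> exists2 w, N w & on_cycle w.
Proof.
move=> Nv hN.
have /choice[f fP] : forall w, exists u, N w -> adj w u /\ N u.
  move=> w; have [Nw|Nw] := pselect (N w); last by exists w.
  by have [e <- Ne] := hN _ Nw; exists (rng e) => _; split => //; exact: adj_edge.
have itN i : N (iter i f v) by elim: i => //= i /fP[].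
have itc i j : (i <= j)%N -> connect adj (iter i f v) (iter j f v).
  move=> ij; rewrite -(subnK ij); elim: (j - i)%N => [|k IH]; first exact: connect0.
  by rewrite addSn /=; apply: connect_trans IH (connect1 _); have [] := fP _ (itN (k + i)%N).
have : ~~ injectiveb (fun i : 'I_#|vert G|.+1 => iter i f v).
  apply/negP => /injectiveP /leq_card; rewrite card_ord ltnn//.
case/injectivePn => i [j ij Eij].
wlog {ij} ij : i j Eij / (i < j)%N.
  by move=> H; case: (ltngtP i j) ij => [h _|h _|/val_inj->]; [exact: (H i j)|exact: (H j i)|rewrite eqxx].
exists (iter i f v) => //.
have [h _] := fP _ (itN i).
by apply: (closed_walk_cycle h); rewrite {2}Eij; exact: (itc i.+1 j).
Qed.

End GraphWalks.

(** * Central sums over arrival paths *)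

Section CStarGen.
Context {R : realType} {A : cstarAlgType R}.

Lemma sub_cstar_gen (X : set A) : X `<=` cstar_gen X.
Proof. by move=> x Xx M [_]; apply. Qed.

Lemma cstar_gen_subalg (X : set A) : cstar_subalg (cstar_gen X).
Proof.
split.
- by move=> M [[]].
- by move=> a x y gx gy M MX; have [[_ Ml _ _ _] _] := MX; apply: Ml; [exact: gx | exact: gy].
- by move=> x y gx gy M MX; have [[_ _ Mm _ _] _] := MX; apply: Mm; [exact: gx | exact: gy].
- by move=> x gx M MX; have [[_ _ _ Ms _] _] := MX; apply: Ms; exact: gx.
- apply: closedP => x h M MX; have [[_ _ _ _ Mc] _] := MX.
  by apply: (closed_approx Mc) => e e0; have [y gy xy] := h e e0; exists y => //; exact: gy.
Qed.

End CStarGen.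

Section CentralSums.
Context {R : realType} {G : fin_digraph} {A : cstarAlgType R}.
Variables (P : vert G -> A) (S : edge G -> A).
Hypothesis CK : CK_family P S.
Hypothesis gen : cstar_gen (range P `|` range S) = setT.
Implicit Types (v w : vert G) (e f : edge G) (es : seq (edge G)) (p q : prepath G).
Implicit Types (W : set (vert G)).
Local Notation pe := (path_elt P S).

Lemma Arr_nil W v : W v -> Arr W (v, [::]).
Proof. by move=> Wv; split. Qed.

Lemma Arr_start W v es : Arr W (v, es) -> W v -> es = [::].
Proof.
by case: es => // e es [_ _ /= h] Wv; case: (h v) => //; rewrite inE eqxx.
Qed.

Lemma Arr_cons W e es : ~ W (src e) ->
  Arr W (src e, e :: es) <-> Arr W (rng e, es).
Proof.
move=> We; rewrite /Arr /is_path /path_rng /=; split.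
  move=> [/andP[_ ch] Wr h]; split => // v vin.
  by apply: h; rewrite inE vin orbT.
move=> [ch Wr h]; rewrite eqxx; split => // v.
by rewrite inE => /orP[/eqP ->//|]; exact: h.
Qed.

Lemma Arr_sub W p : Arr W p -> is_path p /\ W (path_rng p).
Proof. by case. Qed.

(** The common form of both kinds of spanning elements: the unit for z gives e(W), and z in Z(C)
    gives the elements attached to a cycle. *)
Definition arr_sum W (z : A) : A := \sum_(p \in Arr W) (pe p ** z ** (pe p)^†).

Lemma arr_enum W : finite_set (Arr W) -> exists s : seq (prepath G),
  [/\ uniq s, forall p, p \in s <-> Arr W p &
   forall F : prepath G -> A, \sum_(p \in Arr W) F p = \sum_(p <- s) F p].
Proof.
move=> fW; exists (finmap.enum_fset (fset_set (Arr W))); split.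
- exact: finmap.fset_uniq.
- by move=> p; rewrite in_fset_set// inE.
- by move=> F; rewrite fsbig_finite.
Qed.

Lemma idem_arr_sum W : idem P S W = arr_sum W (CK_unit P).
Proof.
by rewrite /arr_sum; apply: eq_fsbigr => p _; have [_ ->] := CK_unitP CK gen (pe p).
Qed.

Lemma arr_sum_star W z : finite_set (Arr W) -> (arr_sum W z)^† = arr_sum W z^†.
Proof.
move=> /arr_enum[s [_ _ sE]]; rewrite /arr_sum !sE cstar_sum.
by apply: eq_bigr => p _; rewrite !cstarM cstarK cmulA.
Qed.

Lemma arr_sum_central_mul W z y : finite_set (Arr W) -> center_of [set: A] y ->
  arr_sum W (y ** z) = y ** arr_sum W z.
Proof.
move=> /arr_enum[s [_ _ sE]] [_ yc]; rewrite /arr_sum !sE cmul_sumr.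
by apply: eq_bigr => p _; rewrite !cmulA (yc (pe p)).
Qed.

Lemma arr_sum_P W z v : finite_set (Arr W) -> arr_sum W z ** P v = P v ** arr_sum W z.
Proof.
move=> /arr_enum[s [_ sP sE]]; rewrite /arr_sum !sE cmul_sumr cmul_suml.
apply: eq_big_seq => -[w es] /sP/Arr_sub[hp _]; rewrite !cmulA -cmulA.
rewrite (pe_star_P CK)// (P_pe CK)//; case: ifP => // _.
by rewrite cmul0r !cmul0l.
Qed.

(** An arrival path that starts in W has length zero, so a single term survives on each side. *)
Lemma arr_sum_S_in W z e : hereditary W -> finite_set (Arr W) -> W (src e) ->
  z ** P (rng e) = P (rng e) ** z -> z ** S e = S e ** z ->
  arr_sum W z ** S e = S e ** z /\ S e ** arr_sum W z = S e ** z.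
Proof.
move=> hW /arr_enum[s [us sP sE]] We zP zS.
have Wr : W (rng e) by apply: hW We (descendant_edge e).
rewrite /arr_sum !sE cmul_sumr cmul_suml; split.
  rewrite (bigD1_seq (src e, [::]))//=; last exact/sP/Arr_nil.
  rewrite big_seq_cond big1 ?addr0.
    rewrite pe0 (Pstar CK) -cmulA (PS CK) eqxx -cmulA zS cmulA.
    by rewrite (PS CK) eqxx.
  move=> [w es] /andP[/sP ps pN]; rewrite -(CK_src CK e) -cmulA (cmulA (_^†)).
  have [hp _] := Arr_sub ps; rewrite (pe_star_P CK)//.
  case: eqP => [ew|_]; last by rewrite cmul0l cmul0r.
  by rewrite -ew in ps pN; rewrite (Arr_start ps We) eqxx in pN.
rewrite (bigD1_seq (rng e, [::]))//=; last exact/sP/Arr_nil.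
rewrite big_seq_cond big1 ?addr0.
  rewrite pe0 (Pstar CK) !cmulA (SP CK) eqxx -cmulA zP cmulA.
  by rewrite (SP CK) eqxx.
move=> [w es] /andP[/sP ps pN]; rewrite -(CK_rng CK e) -!cmulA (cmulA (P _)).
have [hp _] := Arr_sub ps; rewrite (P_pe CK)//.
case: eqP => [ew|_]; last by rewrite cmul0l cmul0r.
by rewrite -ew in ps pN; rewrite (Arr_start ps Wr) eqxx in pN.
Qed.

(** Prefixing e is a bijection from the arrival paths starting at r(e) to those whose first edge is
    e; all other terms vanish. *)
Lemma arr_sum_S_out W z e : finite_set (Arr W) -> ~ W (src e) ->
  arr_sum W z ** S e = S e ** arr_sum W z.
Proof.
move=> /arr_enum[s [us sP sE]] We.
rewrite /arr_sum !sE cmul_sumr cmul_suml.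
pose h p : prepath G := (src e, e :: p.2).
pose Q p := if p.2 is f :: _ then (f == e) else false.
have LHS0 p : p \in s -> ~~ Q p -> pe p ** z ** (pe p)^† ** S e = 0.
  case: p => w [|f es] /sP ps; rewrite /Q /= => fe.
    rewrite pe0 (Pstar CK) -cmulA (PS CK); case: eqP => [we|]; last by rewrite cmul0r.
    by case: ps => _; rewrite /path_rng /= we.
  rewrite (pe_cons CK) -cmulA cstarM -(cmulA _ _ (S e)) (SsS CK) (negbTE fe).
  by rewrite !cmul0r.
have RHS0 p : p \in s -> p.1 != rng e -> S e ** (pe p ** z ** (pe p)^†) = 0.
  case: p => w es /sP/Arr_sub[hp _] /= we.
  rewrite -(CK_rng CK e) -!cmulA (cmulA (P _)) (P_pe CK)// eq_sym (negbTE we).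
  by rewrite cmul0l cmul0r.
rewrite big_seq [LHS](bigID Q)/= [X in _ + X]big1 ?addr0; last first.
  by move=> p /andP[ps /LHS0->].
rewrite [RHS]big_seq [RHS](bigID (fun p => p.1 == rng e))/= [X in _ = _ + X]big1 ?addr0; last first.
  by move=> p /andP[ps /RHS0->].
rewrite -!big_seq_cond -[LHS]big_filter -[RHS]big_filter.
have pm : perm_eq [seq p <- s | Q p] (map h [seq p <- s | p.1 == rng e]).
  apply: uniq_perm; first exact: filter_uniq.
    rewrite map_inj_in_uniq ?filter_uniq// => -[w es] [w' es'].
    by rewrite !mem_filter /= => /andP[/eqP -> _] /andP[/eqP -> _] [->].
  move=> [w es]; rewrite mem_filter; apply/idP/mapP.
    case: es => [|f es]; rewrite /Q //= => /andP[/eqP -> /sP ps].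
    have we : w = src e by case: ps; rewrite /is_path /= => /andP[/eqP].
    rewrite we in ps *.
    exists (rng e, es) => //; rewrite mem_filter eqxx /=.
    exact/sP/(Arr_cons _ We).
  move=> [[w' es'] ]; rewrite mem_filter /= => /andP[/eqP -> ps] [-> ->].
  by rewrite /Q /= eqxx /=; apply/sP/(Arr_cons _ We)/sP.
rewrite (perm_big _ pm) big_map /=.
apply: eq_big_seq => -[w es]; rewrite mem_filter /= => /andP[/eqP -> /sP/Arr_sub[hp _]].
rewrite /h /= (pe_cons CK) cstarM -!cmulA; congr (_ ** (_ ** (_ ** _))).
by rewrite (SsS CK) eqxx (pe_star_P CK)// eqxx.
Qed.

Lemma arr_sum_central W z : finitary W ->
  (forall v, W v -> z ** P v = P v ** z) ->
  (forall e, W (src e) -> z ** S e = S e ** z /\ z ** (S e)^† = (S e)^† ** z) ->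
  center_of [set: A] (arr_sum W z).
Proof.
move=> [hW fW] zP zS.
have com x e : (forall v, W v -> x ** P v = P v ** x) ->
    (forall e, W (src e) -> x ** S e = S e ** x) ->
    arr_sum W x ** S e = S e ** arr_sum W x.
  move=> xP xS; have [We|We] := pselect (W (src e)); last exact: arr_sum_S_out.
  have Wr : W (rng e) by apply: hW We (descendant_edge e).
  by have [-> ->] := arr_sum_S_in hW fW We (xP _ Wr) (xS _ We).
apply: (central_gen CK gen).
- by move=> v; exact: arr_sum_P.
- by move=> e; apply: com => // f /zS[].
(* Commutation with S_e^* is the adjoint of the same statement for z^*, whose hypotheses are the
   adjoints of those on z. *)
- move=> e; have : arr_sum W z^† ** S e = S e ** arr_sum W z^†.
    apply: com => [v Wv|f /zS[_ h]].
      by rewrite -{1}(Pstar CK) -cstarM -zP// cstarM (Pstar CK).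
    by rewrite -{1}[S f]cstarK -cstarM -h cstarM cstarK.
  move=> /(congr1 (@cstar R A)); rewrite !cstarM -!arr_sum_star// !cstarK.
  by move=> ->.
Qed.

Lemma idem_central W : finitary W -> center_of [set: A] (idem P S W).
Proof.
move=> fW; have u x : CK_unit P ** x = x ** CK_unit P.
  by have [-> ->] := CK_unitP CK gen x.
by rewrite idem_arr_sum; apply: arr_sum_central.
Qed.

Lemma idem_P W u : finitary W -> W u -> idem P S W ** P u = P u.
Proof.
move=> [hW /arr_enum[s [us sP sE]]] Wu; rewrite /idem sE cmul_suml.
rewrite (bigD1_seq (u, [::]))//=; last exact/sP/Arr_nil.
rewrite big_seq_cond big1 ?addr0.
  by rewrite pe0 (Pstar CK) -cmulA !(PP CK) !eqxx (PP CK) eqxx.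
move=> [w es] /andP[/sP ps pN]; rewrite -cmulA.
have [hp _] := Arr_sub ps; rewrite (pe_star_P CK)//.
case: eqP => [ew|_]; last by rewrite cmul0r.
by rewrite -ew in ps pN; rewrite (Arr_start ps Wu) eqxx in pN.
Qed.

Lemma idem_mul W y : finitary W -> center_of [set: A] y ->
  y ** idem P S W = arr_sum W y.
Proof.
move=> [hW fW] yc; rewrite idem_arr_sum -arr_sum_central_mul//.
by have [_ ->] := CK_unitP CK gen y.
Qed.

(** * Corners of the algebra at cycles without exit *)

Section NECycle.
Variable C : seq (edge G).
Hypothesis NE : NE_cycle C.

Definition cycle_unit : A := \sum_(v | v \in map src C) P v.

Lemma cycle_unit_P v : v \in map src C -> cycle_unit ** P v = P v /\ P v ** cycle_unit = P v.
Proof.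
move=> vC; rewrite /cycle_unit cmul_suml cmul_sumr; split.
  rewrite (bigD1 v)//= (PP CK) eqxx big1 ?addr0// => w /andP[_ wv].
  by rewrite (PP CK) (negbTE wv).
rewrite (bigD1 v)//= (PP CK) eqxx big1 ?addr0// => w /andP[_ wv].
by rewrite (PP CK) eq_sym (negbTE wv).
Qed.

Lemma cycle_unit_star : cycle_unit^† = cycle_unit.
Proof. by rewrite cstar_sum; apply: eq_bigr => v _; exact: (Pstar CK). Qed.

Lemma NE_edge e : cycle_vert C (src e) -> e \in C.
Proof.
have [_ noexit] := NE; move=> eC; apply: contra_notT noexit => eNC.
by exists e.
Qed.

Lemma CK_cycle_P v : cycle_vert C v -> CK_cycle P S C (P v).
Proof. by move=> vC; apply: sub_cstar_gen; left; exists v. Qed.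

Lemma CK_cycle_S e : cycle_vert C (src e) -> CK_cycle P S C (S e).
Proof. by move=> /NE_edge eC; apply: sub_cstar_gen; right; exists e. Qed.

Lemma CK_cycle_path v es : cycle_vert C v -> chain v es -> CK_cycle P S C (pe (v, es)).
Proof.
have [_ _ Mm _ _] := cstar_gen_subalg ((P @` cycle_vert C) `|` (S @` [set e | e \in C])).
elim: es v => [|e es IH] v vC /=; first by move=> _; exact: CK_cycle_P.
move=> /andP[/eqP ev ch]; rewrite -ev in vC.
rewrite (pe_cons CK); apply: Mm; first exact: CK_cycle_S.
by apply: IH => //; exact: (NE_cycle_hereditary NE vC (descendant_edge e)).
Qed.

(** Paths starting on an NE-cycle stay on it, so compressed monomials lie in CK(C); density and
    closedness do the rest. *)
Lemma CK_cycle_corner y : CK_cycle P S C (cycle_unit ** y ** cycle_unit).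
Proof.
have [M0 Ml Mm Ms Mc] := cstar_gen_subalg ((P @` cycle_vert C) `|` (S @` [set e | e \in C])).
have un : `|cycle_unit| <= 1.
  apply: proj_norm_le1; split; last exact: cycle_unit_star.
  rewrite {2}/cycle_unit cmul_sumr; apply: eq_bigr => v vC.
  by have [] := cycle_unit_P vC.
apply: (closed_approx Mc).
apply: (approx_linear (f := fun x => cycle_unit ** x ** cycle_unit) (K := 1) (M := poly_part P S)) => //.
- move=> x w; rewrite mul1r -cmulBl -cmulBr.
  apply: le_trans (normr_cmul _ _) _; rewrite -[leRHS]mulr1 ler_pM//.
  exact: norm_cmul_le1.
- move=> x xp; apply: sub_approx; move: x xp.
  apply: (@lin_span_ind _ _ _ [set x | CK_cycle P S C (cycle_unit ** x ** cycle_unit)]).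
    apply: lin_closed_preim; first by split.
    by move=> a x w; rewrite cmulDr cmulDl cmulZr cmulZl.
  have upe p : is_path p -> CK_cycle P S C (cycle_unit ** pe p).
    case: p => v es hp; rewrite /cycle_unit cmul_suml.
    apply: lin_closed_sum; first by split.
    move=> w wC; rewrite (P_pe CK)//; case: eqP => [wv|_]; last exact: M0.
    by apply: CK_cycle_path => //; rewrite -wv.
  move=> _ [p [q [hp hq pq ->]]] /=; rewrite cmulA -cmulA.
  apply: Mm; first exact: upe.
  by rewrite -cycle_unit_star -cstarM; apply: Ms; exact: upe.
- exact: (poly_dense CK gen).
Qed.

Lemma center_cycle_corner y : center_of [set: A] y ->
  center_cycle P S C (y ** cycle_unit).
Proof.
move=> [_ yc]; have uu : cycle_unit ** cycle_unit = cycle_unit.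
  rewrite {2}/cycle_unit cmul_sumr; apply: eq_bigr => v vC.
  by have [] := cycle_unit_P vC.
split; first by rewrite -uu cmulA (yc cycle_unit)//; exact: CK_cycle_corner.
move=> x; suff ux : CK_cycle P S C x -> cycle_unit ** x = x /\ x ** cycle_unit = x.
  by move=> /ux[h1 h2]; rewrite -cmulA h1 yc// -{1}h2 -!cmulA (yc cycle_unit).
move=> gx; apply: (gx [set x | cycle_unit ** x = x /\ x ** cycle_unit = x]); split.
  by apply: unit_subalg; exact: cycle_unit_star.
move=> _ [[v vC <-]|[e eC <-]] /=; first exact: cycle_unit_P.
split.
  have [h _] := cycle_unit_P (map_f src eC).
  by rewrite -(CK_src CK) cmulA h.
have [hC _] := NE; have [_ h] := cycle_unit_P (cycle_edge_next hC eC).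
by rewrite -{1}(CK_rng CK) -cmulA h (CK_rng CK).
Qed.

(** An arrival path ends on C, hence absorbs [cycle_unit] on its right; so y times [cycle_unit]
    serves as z. *)
Lemma cycle_subspace_mul y : finitary (cycle_vert C) -> center_of [set: A] y ->
  cycle_subspace P S C (y ** idem P S (cycle_vert C)).
Proof.
move=> fC yc; exists (y ** cycle_unit); first exact: center_cycle_corner.
rewrite idem_mul//; apply: eq_fsbigr => p; rewrite inE => -[_ rC _].
rewrite cmulA -(cmulA _ cycle_unit); congr (_ ** _).
have := pe_P CK (path_rng p) p; rewrite eqxx => <-.
by rewrite cstarM (Pstar CK) cmulA; have [-> _] := cycle_unit_P rC.
Qed.

Lemma cycle_subspace_central x : finitary (cycle_vert C) ->
  cycle_subspace P S C x -> center_of [set: A] x.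
Proof.
move=> fC [z [zM zc] <-]; apply: arr_sum_central => // [v vC|e eC].
  by apply: zc; exact: CK_cycle_P.
have [_ _ _ Ms _] := cstar_gen_subalg ((P @` cycle_vert C) `|` (S @` [set e | e \in C])).
by split; apply: zc; [|apply: Ms]; exact: CK_cycle_S.
Qed.

End NECycle.
End CentralSums.

(** * The center *)

Section Center.
Context {R : realType} {G : fin_digraph} {A : cstarAlgType R}.
Variables (P : vert G -> A) (S : edge G -> A).
Hypothesis CK : CK_family P S.
Hypothesis gen : cstar_gen (range P `|` range S) = setT.
Hypothesis P_neq0 : forall v, P v != 0.
Implicit Types (u v w : vert G) (e f : edge G) (W : set (vert G)) (y z : A).
Local Notation pe := (path_elt P S).
Local Notation central := (center_of [set: A]).

Lemma centralB y z : central y -> central z -> central (y - z).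
Proof.
move=> [_ yc] [_ zc]; split => // x _.
by rewrite cmulBl cmulBr yc// zc.
Qed.

Lemma centralM y z : central y -> central z -> central (y ** z).
Proof.
move=> [_ yc] [_ zc]; split => // x _.
by rewrite -cmulA zc// cmulA yc// cmulA.
Qed.

Lemma central_lin_closed : lin_closed (central : set A).
Proof.
split; first by split => // x _; rewrite cmul0l cmul0r.
move=> a y z [_ yc] [_ zc]; split => // x _.
by rewrite cmulDl cmulDr cmulZl cmulZr yc// zc.
Qed.

Definition sink v := forall e, src e != v.

(** No edge leaves u, so P_u S_p vanishes unless p is the trivial path at u. *)
Lemma sink_corner u x : sink u -> poly_part P S x ->
  exists a : R[i], P u ** x ** P u = a *: P u.
Proof.
move=> su; apply: (@lin_span_ind _ _ _ [set x | exists a : R[i], P u ** x ** P u = a *: P u]).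
  split; first by exists 0; rewrite cmul0r cmul0l scale0r.
  move=> a y z [b yb] [c zc]; exists (a * b + c).
  by rewrite cmulDr cmulDl cmulZr cmulZl yb zc scalerA scalerDl.
have suP p : is_path p -> P u ** pe p = if p == (u, [::]) then P u else 0.
  case: p => v es hp; rewrite (P_pe CK)//; case: eqP => [uv|uv]; last first.
    by case: eqP => // -[vu _]; rewrite vu in uv.
  case: es hp => [|e es]; first by rewrite -uv eqxx.
  by rewrite /is_path /= => /andP[/eqP ev]; have := su e; rewrite ev uv eqxx.
move=> _ [p [q [hp hq _ ->]]] /=.
rewrite cmulA -cmulA -{2}(Pstar CK) -cstarM !suP//.
case: ifP => _; last by exists 0; rewrite cmul0l scale0r.
case: ifP => _; last by exists 0; rewrite cstar0 cmul0r scale0r.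
by exists 1; rewrite (Pstar CK) (PP CK) eqxx scale1r.
Qed.

Lemma sink_scalar u y : sink u -> central y -> exists a : R[i], y ** P u = a *: P u.
Proof.
move=> su [_ yc]; apply: line_closed => // e e0.
have [x xp yx] := poly_dense CK gen y e0.
have [a xa] := sink_corner su xp; exists a; rewrite -xa.
have -> : y ** P u = P u ** y ** P u by rewrite -yc// -cmulA (PP CK) eqxx.
rewrite -cmulBl -cmulBr; apply: le_lt_trans yx.
have pu : `|P u| <= 1 by apply: proj_norm_le1; exact: (CK_proj CK).
apply: le_trans (normr_cmul _ _) _; rewrite -[leRHS]mulr1 ler_pM//.
exact: norm_cmul_le1.
Qed.

Definition scalar_set y (a : R[i]) : set (vert G) := [set v | y ** P v = a *: P v].

(** P_(r(e)) = S_e^* S_e, and y S_e = a S_e as soon as y P_(s(e)) = a P_(s(e)). *)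
Lemma scalar_set_hereditary y a : central y -> hereditary (scalar_set y a).
Proof.
move=> [_ yc]; apply: hereditaryP => e; rewrite /scalar_set /= => h.
have <- : (S e)^† ** S e = P (rng e) by rewrite (SsS CK) eqxx.
have ySe : y ** S e = a *: S e.
  by rewrite -{1}(CK_src CK e) cmulA h cmulZl (CK_src CK).
by rewrite cmulA yc// -cmulA ySe cmulZr.
Qed.

Lemma cycle_exit_scalar_set y C v : central y -> is_cycle C -> cycle_vert C v ->
  (exists e, exit_of C e) -> exists a, scalar_set y a v.
Proof.
move=> yc hC vC [e [eC eNC]].
have [e0 [C' [hC' <- CC]]] := cycle_rot hC vC.
apply: (cycle_with_exit_scalar CK gen P_neq0 hC' yc); exists e.
split; last by rewrite CC.
by move: eC; rewrite /cycle_vert /= -[in X in X -> _](eq_mem_map _ CC).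
Qed.

(** Otherwise a cycle outside the set leads to some w inside. If it has an exit, y is a scalar b
    along it and down to w, and b = a because P_w is nonzero. If not, w lies on the cycle, and so
    does everything reachable from w. Either way the cycle meets the set at v, a contradiction. *)
Lemma scalar_set_finitary y a : central y -> finitary (scalar_set y a).
Proof.
move=> yc; have hW := @scalar_set_hereditary y a yc; split => //.
apply: contrapT => /infinite_Arr[v [vW [C hC vC] [w wW vw]]]; apply: vW.
have [ex|nex] := pselect (exists e, exit_of C e).
  have [b vb] := cycle_exit_scalar_set yc hC vC ex.
  have wb := @scalar_set_hereditary y b yc _ _ vb vw.
  suff -> : a = b by [].
  apply/eqP; rewrite -subr_eq0; have : (a - b) *: P w == 0.
    by rewrite scalerBl -wW -wb subrr.
  by rewrite scaler_eq0 (negbTE (P_neq0 w)) orbF.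
have NE : NE_cycle C by [].
have wC := NE_cycle_hereditary NE vC vw.
exact: hW wW (cycle_connected hC wC vC).
Qed.

Lemma scalar_idem y a : central y ->
  y ** idem P S (scalar_set y a) = a *: idem P S (scalar_set y a).
Proof.
move=> yc; have [_ ycom] := yc.
have fW := scalar_set_finitary a yc; rewrite (idem_mul CK gen)//.
have [s [_ sP sE]] := @arr_enum R G A _ (proj2 fW).
rewrite /arr_sum /idem !sE scaler_sumr; apply: eq_big_seq => p /sP[_ pr _].
have := pe_P CK (path_rng p) p; rewrite eqxx => pP.
have {}pr : y ** P (path_rng p) = a *: P (path_rng p) by exact: pr.
rewrite -{1}pP -(cmulA (pe p)) -ycom// pr cmulZr cmulZl.
by rewrite pP.
Qed.

Definition spanning : set A :=
  [set idem P S W | W in [set W : set (vert G) | W !=set0 /\ finitary W]]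
     `|` \bigcup_(C in [set C : seq (edge G) | finitary_NE_cycle C])
           cycle_subspace P S C.

(** As u lies in W, y - y e(W) vanishes at u, at the cost of an element of the span. *)
Lemma peel_set y u : central y -> sink u \/ on_cycle u ->
  exists W, [/\ W u, finitary W & lin_span spanning (y ** idem P S W)].
Proof.
move=> yc hu.
have scalar_case a : scalar_set y a u ->
    exists W, [/\ W u, finitary W & lin_span spanning (y ** idem P S W)].
  move=> ua; exists (scalar_set y a); have fW := scalar_set_finitary a yc; split => //.
  rewrite scalar_idem//; apply: (lin_closedZ _ (lin_span_closed spanning)).
  by apply: sub_lin_span; left; exists (scalar_set y a) => //; split => //; exists u.
case: hu => [su|[C hC uC]]; first by have [a] := sink_scalar su yc; exact: scalar_case.
have [ex|nex] := pselect (exists e, exit_of C e).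
  by have [a] := cycle_exit_scalar_set yc hC uC ex; exact: scalar_case.
have NE : NE_cycle C by [].
have hV := NE_cycle_hereditary NE.
have [fC|/infinite_Arr[v [vC [C1 hC1 vC1] [w wC vw]]]] := pselect (finite_set (Arr (cycle_vert C))).
  exists (cycle_vert C); split => //.
  apply: sub_lin_span; right; exists C => //.
  exact: (cycle_subspace_mul CK gen).
have [ex1|nex1] := pselect (exists e, exit_of C1 e).
  have [a va] := cycle_exit_scalar_set yc hC1 vC1 ex1; apply: (scalar_case a).
  apply: (@scalar_set_hereditary y a yc v u va).
  exact: descendant_trans vw (cycle_connected hC wC uC).
(* An exitless C1 would contain w; going round it from w back to v, heredity of V(C) would put v on
   C. *)
have NE1 : NE_cycle C1 by [].
have wC1 := NE_cycle_hereditary NE1 vC1 vw.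
by case: vC; exact: hV wC (cycle_connected hC1 wC1 vC1).
Qed.

Lemma peel (s : seq (vert G)) y : central y ->
  (forall u, u \in s -> sink u \/ on_cycle u) ->
  exists y', [/\ central y', lin_span spanning (y - y') &
    forall u, u \in s -> y' ** P u = 0].
Proof.
move=> yc; elim: s => [|u s IH] hs.
  exists y; split => //; rewrite subrr.
  by case: (lin_span_closed spanning).
have [|y' [y'c yy' y's]] := IH; first by move=> v vs; apply: hs; rewrite inE vs orbT.
have [|W [Wu fW yW]] := @peel_set y' u y'c; first by apply: hs; rewrite inE eqxx.
have ic := idem_central CK gen fW; have [_ y'com] := y'c.
exists (y' - y' ** idem P S W); split.
- by apply: centralB => //; exact: centralM.
- rewrite opprB addrCA addrC.
  exact: (lin_closedD (lin_span_closed spanning)).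
- move=> v; rewrite inE cmulBl => /orP[/eqP ->|vs].
    by rewrite -cmulA (idem_P CK)// subrr.
  (* y' e(W) P_v = e(W) y' P_v: vertices already treated stay annihilated. *)
  by rewrite (y'com (idem P S W))// -cmulA y's// cmul0r subr0.
Qed.

Lemma central_eq0 y : central y ->
  (forall u, sink u \/ on_cycle u -> y ** P u = 0) -> y = 0.
Proof.
move=> [_ yc] h.
suff yP v : y ** P v = 0.
  rewrite -(proj2 (CK_unitP CK gen y)) /CK_unit cmul_sumr big1// => v _.
apply: contrapT => vN.
(* The support of y contains no sink, and by the summation relation each of its vertices has an edge
   leading back into it. *)
have [||w wN wc] := @persistent_cycle G [set v | y ** P v <> 0] v; first exact: vN.
  move=> w /= wN.
  have [ws|] := pselect (exists e, src e = w); last first.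
    move=> nws; case: wN; apply: h; left => e; apply/eqP => ew.
    by apply: nws; exists e.
  apply: contrapT => nx; apply: wN.
  rewrite (CK_sum CK ws) cmul_sumr big1// => e /eqP ew.
  rewrite cmulA yc// -{1}(CK_rng CK e) -!cmulA (cmulA (P _)) -(yc (P _))//.
  have -> : y ** P (rng e) = 0 by apply: contrapT => rN; apply: nx; exists e.
  by rewrite cmul0l cmul0r.
by apply: wN; apply: h; right.
Qed.

Lemma center_eq_span : central = lin_span spanning.
Proof.
apply/seteqP; split => z.
  move=> zc; pose s := [seq u <- enum (vert G) | `[< sink u \/ on_cycle u >]].
  have [|y [yc zy ys]] := @peel s z zc.
    by move=> u; rewrite mem_filter => /andP[/asboolP].
  suff y0 : y = 0 by rewrite y0 subr0 in zy.
  apply: central_eq0 => // u hu; apply: ys.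
  by rewrite mem_filter mem_enum andbT; apply/asboolP.
apply: lin_span_ind; first exact: central_lin_closed.
move=> x [[W [_ fW] <-]|[C [NE fC] xC]]; first exact: (idem_central CK gen).
exact: (cycle_subspace_central CK gen NE fC xC).
Qed.

End Center.

Theorem theorem1 (R : realType) (G : fin_digraph) (A : cstarAlgType R)
    (P : vert G -> A) (S : edge G -> A) (hA : is_CK_algebra P S) :
  center_of [set: A] =
  lin_span
    ([set idem P S W | W in [set W : set (vert G) | W !=set0 /\ finitary W]]
     `|` \bigcup_(C in [set C : seq (edge G) | finitary_NE_cycle C])
           cycle_subspace P S C).
Proof.
have P0 := CK_proj_neq0 hA; have [CK gen _] := hA.
exact: (center_eq_span CK gen P0).
Qed.
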